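(* Let $T:\mathcal{H}\to\mathcal{H}'$ be a bounded linear operator between complex Hilbert spaces, and let $\mathcal{E}$ be the spectral measure of $A=\sqrt{T^\star T}$. (1) For every $\mu\ge 0$, all maximal $[0,\mu]$-subspaces with respect to $T$ (equivalently, with respect to $A$) are isomorphic; in particular each is isomorphic to $\mathcal{E}([0,\mu])\mathcal{H}$, and hence they all have the same Hilbert dimension $\dim\mathcal{E}([0,\mu])\mathcal{H}$. (2) If $\mu\ge\mu'\ge 0$, then for every maximal $[0,\mu]$-subspace $Y$ and every maximal $[0,\mu']$-subspace $Y'$ with $Y'\subset Y$, the quotient $Y/Y'$ is isomorphic to $\mathcal{E}(]\mu',\mu])\mathcal{H}$.
   Context: $\mathcal{E}$ is the projection-valued measure on the Borel subsets of $[0,\infty[$ with $A=\int_{[0,\infty[}\lambda\,d\mathcal{E}(\lambda)$, where $A=\sqrt{T^\star T}$ is the positive semi-definite square root. For an interval $I\subset[0,\infty[$, a linear subspace $Y\subset\mathcal{H}$ (not necessarily closed) is an $I$-subspace with respect to $T$ if $\|Tx\|/\|x\|\in I$ for every $0\ne x\in Y$. A maximal $I$-subspace is an $I$-subspace that is maximal with respect to inclusion among $I$-subspaces; for $I=[0,\mu]$ maximal $I$-subspaces are closed. (Since $\|Tx\|=\|Ax\|$ for all $x$, being an $I$-subspace with respect to $T$ or to $A$ is the same.) ''Isomorphic'' means linearly homeomorphic (there is a bounded linear bijection with bounded inverse); $Y/Y'$ carries the quotient topology. The Hilbert dimension is the cardinality of an orthonormal basis. $]\mu',\mu]=\{x:\mu'<x\le\mu\}$.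 *)

(* Defs.v *)
From HB Require Import structures.
From mathcomp Require Import all_boot all_order all_algebra.
From mathcomp Require Import sesquilinear generic_quotient ring_quotient.
From mathcomp Require Import all_classical all_reals all_analysis.
From mathcomp Require Import complex.

Set Implicit Arguments.
Unset Strict Implicit.
Unset Printing Implicit Defensive.

Import Order.TTheory GRing.Theory Num.Theory.
Import numFieldNormedType.Exports.

Local Open Scope classical_set_scope.
Local Open Scope ring_scope.
Local Open Scope complex_scope.
Local Open Scope quotient_scope.

(* The inner product is linear in its first argument. *)
HB.mixin Record CompleteNormedModule_isHilbert (R : realType) (H : Type)
    & CompleteNormedModule R[i] H := {
  inner : {dot H for (@Num.conj R[i])} ;
  norm_inner : forall x : H, `|x| ^+ 2 = inner x x
}.

#[short(type="hilbertType")]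
HB.structure Definition Hilbert (R : realType) :=
  {H of CompleteNormedModule R[i] H & CompleteNormedModule_isHilbert R H}.

(* The norm of a normed space over R[i] takes its values in R[i]. *)
Definition rnorm (R : realType) (V : normedModType R[i]) (x : V) : R :=
  complex.Re `|x|.

Lemma rnormE (R : realType) (V : normedModType R[i]) (x : V) :
  `|x| = (rnorm x)%:C.
Proof.
have := normr_ge0 x; rewrite /rnorm; case: `|x| => a b.
by rewrite lecE /= => /andP[/eqP-> _].
Qed.

Lemma rnorm_ge0 (R : realType) (V : normedModType R[i]) (x : V) :
  0 <= rnorm x.
Proof. by have := normr_ge0 x; rewrite rnormE lecR. Qed.

Lemma rnorm_cvg (R : realType) (V : normedModType R[i]) (u : nat -> V) (l : V) :
  u @ \oo --> l -> (rnorm (u n)) @[n --> \oo] --> rnorm l.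
Proof.
move=> ul; apply/cvgrPdist_lt => e e0.
have /cvgrPdist_lt/(_ e%:C) : u @ \oo --> l by [].
rewrite ltcR => /(_ e0); apply: filterS => n.
move=> /(le_lt_trans (ler_dist_dist _ _)).
rewrite !rnormE -rmorphB /= normc_def /= expr0n /= addr0 sqrtr_sqr ltcR.
by [].
Qed.

Section operators.
Context (R : realType).

Definition adjoint (H K : hilbertType R) (T : {linear H -> K})
    (Ts : {linear K -> H}) : Prop :=
  forall (x : H) (y : K), inner (T x) y = inner x (Ts y).

(* Over the complex numbers, the second condition implies that A is
   self-adjoint. *)
Definition positive_sqrt (H : hilbertType R) (A : {linear H -> H})
    (S : H -> H) : Prop :=
  [/\ bounded_near A (nbhs (0 : H)),
      forall x : H, 0 <= inner (A x) x
    & forall x : H, A (A x) = S x].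

Definition orthogonal_projection (H : hilbertType R) (P : {linear H -> H})
    : Prop :=
  (forall x : H, P (P x) = P x) /\
  (forall x y : H, inner (P x) y = inner x (P y)).

End operators.

Section spectral_measures.
Context (R : realType).

Definition halfline : set R := `[0, +oo[%classic.

(* Only the values of [pvm_proj] at Borel subsets of [0, +oo[ matter. *)
Record pvm (H : hilbertType R) := Pvm {
  pvm_proj :> set R -> {linear H -> H} ;
  pvm_orthogonal_projection : forall B, measurable B -> B `<=` halfline ->
    orthogonal_projection (pvm_proj B) ;
  pvm_set0 : forall x : H, pvm_proj set0 x = 0 ;
  pvm_setT : forall x : H, pvm_proj halfline x = x ;
  pvm_setI : forall B C, measurable B -> B `<=` halfline ->
    measurable C -> C `<=` halfline ->
    forall x : H, pvm_proj (B `&` C) x = pvm_proj B (pvm_proj C x) ;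
  pvm_sigma_additive : forall F : nat -> set R,
    (forall n, measurable (F n)) -> (forall n, F n `<=` halfline) ->
    trivIset setT F -> forall x : H,
    (\sum_(i < n) pvm_proj (F i) x) @[n --> \oo] -->
      pvm_proj (\bigcup_n F n) x
}.

(* For Borel B in [0, +oo[ this is <E(B)x, x>; the form |E(B)x|^2 makes it
   nonnegative on all sets, as the library requires of a measure. *)
Definition spectral_measure (H : hilbertType R) (E : pvm H) (x : H)
    (B : set R) : \bar R :=
  ((rnorm (E (B `&` halfline) x)) ^+ 2)%:E.

Section spectral_measure_is_measure.
Context (H : hilbertType R) (E : pvm H) (x : H).

Let measurable_halfline : measurable halfline.
Proof. exact: measurable_itv. Qed.

Lemma spectral_measureE B : measurable B -> B `<=` halfline ->
  inner (E B x) x = (fine (spectral_measure E x B))%:C.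
Proof.
move=> mB sB; have [PP Psa] := pvm_orthogonal_projection E mB sB.
rewrite /spectral_measure (setIidl sB) /= -[in LHS]PP Psa -norm_inner rnormE.
by rewrite rmorphXn.
Qed.

Let mu0 : spectral_measure E x set0 = 0%E.
Proof.
by rewrite /spectral_measure set0I pvm_set0 /rnorm normr0 expr0n.
Qed.

Let mu_ge0 B : (0 <= spectral_measure E x B)%E.
Proof. by rewrite lee_fin sqr_ge0. Qed.

Let mu_sigma : semi_sigma_additive (spectral_measure E x).
Proof.
move=> F mF tF mUF; pose G n := F n `&` halfline.
have mG n : measurable (G n) by exact: measurableI.
have sG n : G n `<=` halfline by move=> ? [].
have tG : trivIset setT G.
  apply/trivIsetP => i j _ _ ij; rewrite /G setIACA setIid.
  by move/trivIsetP: tF => /(_ i j I I ij) ->; rewrite set0I.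
have -> : spectral_measure E x (\bigcup_n F n) =
    ((rnorm (E (\bigcup_n G n) x)) ^+ 2)%:E.
  by rewrite /spectral_measure setI_bigcupl.
have sumE n : (\sum_(0 <= i < n) spectral_measure E x (F i))%E =
    ((rnorm (\sum_(i < n) E (G i) x)) ^+ 2)%:E.
  rewrite big_mkord /spectral_measure sumEFin; congr (_%:E).
  apply: complexI; rewrite rmorphXn /= -rnormE norm_inner.
  rewrite linear_sumlz rmorph_sum /=; apply: eq_bigr => i _.
  rewrite linear_sumr (bigD1 i) //= big1 ?addr0.
    by rewrite rmorphXn /= -rnormE norm_inner.
  move=> j ji; have [_ sa] := pvm_orthogonal_projection E (mG i) (@sG i).
  rewrite sa -(pvm_setI E (mG i) (@sG i) (mG j) (@sG j)).
  move/trivIsetP : tG => /(_ i j I I).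
  by rewrite -[(i : nat) != j]/(i != j) eq_sym => -> //; rewrite pvm_set0 linear0r.
under eq_fun do rewrite sumE.
apply: cvg_EFin; first by apply: nearW.
have h := rnorm_cvg (@pvm_sigma_additive _ E G mG sG tG x).
by apply: cvgM.
Qed.

HB.instance Definition _ := isMeasure.Build _ _ _ (spectral_measure E x)
  mu0 mu_ge0 mu_sigma.

End spectral_measure_is_measure.

(* A = \int lambda dE(lambda), in the weak sense: <Ax, x> is the integral of
   lambda against <E(.)x, x>, for all x (by polarization this fixes A). *)
Definition spectral_integral (H : hilbertType R) (E : pvm H)
    (A : {linear H -> H}) : Prop :=
  forall x : H,
    (spectral_measure E x).-integrable halfline (fun l : R => l%:E) /\
    inner (A x) x =
      (\int[spectral_measure E x]_(l in halfline) l)%R%:C.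

End spectral_measures.

Section spaces.
Context (K : numFieldType).

(* linearly homeomorphic *)
Definition isomorphic (V W : preTopologicalLmodType K) : Prop :=
  exists (f : {linear V -> W}) (g : W -> V),
    [/\ cancel f g, cancel g f, continuous f & continuous g].

(* A not necessarily closed linear subspace is a [submodClosed] predicate; as a
   space, it carries the topology induced by the ambient one. *)
Definition subsp (V : preTopologicalLmodType K) (Y : submodClosed V) : Type :=
  {x : V | x \in Y}.

HB.instance Definition _ (V : preTopologicalLmodType K) (Y : submodClosed V) :=
  SubChoice.on (subsp Y).
HB.instance Definition _ (V : preTopologicalLmodType K) (Y : submodClosed V) :=
  [SubChoice_isSubLmodule of subsp Y by <:].
HB.instance Definition _ (V : preTopologicalLmodType K) (Y : submodClosed V) :=
  Topological.copy (subsp Y) (initial_topology (val : subsp Y -> V)).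

Section subsp_in.
Context (V : preTopologicalLmodType K) (Y Y' : submodClosed V).

(* Y' as a subspace of the space Y (when Y' is contained in Y) *)
Definition subsp_in : {pred subsp Y} := fun x => val x \in Y'.

Let subsp_in_closed : GRing.subsemimod_closed subsp_in.
Proof.
have inE x : (x \in subsp_in) = (val x \in Y') by [].
split; first split.
- by rewrite inE rpred0.
- by move=> u v; rewrite !inE; exact: rpredD.
- by move=> a u; rewrite !inE; exact: rpredZ.
Qed.
HB.instance Definition _ := GRing.isSubmodClosed.Build _ _ subsp_in subsp_in_closed.

End subsp_in.

Section quotient_space.
Context (V : preTopologicalLmodType K) (W : submodClosed V).

Definition zmod_of_submod : {pred V} := W.

Let zmod_of_submod_closed : zmod_closed zmod_of_submod.
Proof. exact: (GRing.submod_closedB (GRing.submodClosedP W)). Qed.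
HB.instance Definition _ :=
  GRing.isZmodClosed.Build V zmod_of_submod zmod_of_submod_closed.

(* V/W with the quotient topology; the quotient of the library is only an
   abelian group, whence the scaling below. *)
Definition quotsp : Type := quotient_topology (Quotient.quot zmod_of_submod).

HB.instance Definition _ := Topological.on quotsp.

Local Notation Q := (Quotient.quot zmod_of_submod).

HB.instance Definition _ := GRing.isZmodule.Build quotsp
  (@Quotient.addqA _ _ : associative (@Quotient.add _ zmod_of_submod))
  (@Quotient.addqC _ _) (@Quotient.add0q _ _) (@Quotient.addNq _ _).

Definition quotsp_scale (a : K) (q : quotsp) : quotsp :=
  \pi_Q (a *: repr (q : Q)).

Lemma quotsp_eqP (x y : V) : reflect (\pi_Q x = \pi_Q y) (x - y \in W).
Proof.
have -> : (x - y \in W) = (\pi_Q x == \pi_Q y).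
  by rewrite -Quotient.idealrBE.
exact: eqP.
Qed.

Lemma quotsp_scale_pi (a : K) (x : V) :
  quotsp_scale a (\pi_Q x : Q) = \pi_Q (a *: x).
Proof.
apply/quotsp_eqP; rewrite -scalerBr rpredZ //.
by apply/quotsp_eqP; rewrite reprK.
Qed.

Lemma quotsp_add_pi (x y : V) :
  (\pi_Q x : quotsp) + (\pi_Q y : quotsp) = \pi_Q (x + y).
Proof. by rewrite Quotient.pi_add. Qed.

Let scaleA (a b : K) (q : quotsp) :
  quotsp_scale a (quotsp_scale b q) = quotsp_scale (a * b) q.
Proof.
by rewrite -[q](@reprK _ Q) !quotsp_scale_pi scalerA.
Qed.

Let scale1 : left_id 1 quotsp_scale.
Proof. by move=> q; rewrite -[q](@reprK _ Q) quotsp_scale_pi scale1r. Qed.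

Let scaleDr : right_distributive quotsp_scale +%R.
Proof.
move=> a p q; rewrite -[p](@reprK _ Q) -[q](@reprK _ Q).
by rewrite quotsp_add_pi !quotsp_scale_pi quotsp_add_pi scalerDr.
Qed.

Let scaleDl (q : quotsp) : {morph quotsp_scale^~ q : a b / a + b}.
Proof.
move=> a b; rewrite -[q](@reprK _ Q).
by rewrite !quotsp_scale_pi quotsp_add_pi scalerDl.
Qed.

HB.instance Definition _ := GRing.Zmodule_isLmodule.Build K quotsp
  scaleA scale1 scaleDr scaleDl.

End quotient_space.

Section range.
Context (V W : preTopologicalLmodType K) (f : {linear V -> W}).

Definition lrange : {pred W} := fun y => `[< exists x, f x = y >].

Let lrange_closed : GRing.subsemimod_closed lrange.
Proof.
split; first split.
- by apply/asboolP; exists 0; rewrite linear0.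
- move=> u v /asboolP[x <-] /asboolP[y <-].
  by apply/asboolP; exists (x + y); rewrite linearD.
- by move=> a u /asboolP[x <-]; apply/asboolP; exists (a *: x); rewrite linearZ.
Qed.
HB.instance Definition _ := GRing.isSubmodClosed.Build _ _ lrange lrange_closed.

End range.
End spaces.
Arguments subsp_in {K V} Y Y'.

Section maximal_subspaces.
Context (R : realType) (H K : hilbertType R) (T : {linear H -> K}).

Definition interval_subspace (I : interval R) (Y : submodClosed H) : Prop :=
  forall x : H, x \in Y -> x != 0 -> rnorm (T x) / rnorm x \in I.

Definition maximal_interval_subspace (I : interval R) (Y : submodClosed H)
    : Prop :=
  interval_subspace I Y /\
  forall Z : submodClosed H, interval_subspace I Z ->
    {subset Y <= Z} -> {subset Z <= Y}.

End maximal_subspaces.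

Section hilbert_dimension.
Context (R : realType).

Definition linear_span (H : hilbertType R) (B : set H) : set H :=
  [set x | exists (n : nat) (a : 'I_n -> R[i]) (b : 'I_n -> H),
     (forall i, B (b i)) /\ x = \sum_i a i *: b i].

Definition orthonormal_basis (H : hilbertType R) (Y : submodClosed H)
    (B : set H) : Prop :=
  [/\ forall x, B x -> x \in Y,
      forall x y, B x -> B y -> inner x y = (x == y)%:R
    & forall y, y \in Y -> closure (linear_span B) y].

(* Y and Z have orthonormal bases, and these all have the same cardinality. *)
Definition same_hilbert_dim (H K : hilbertType R) (Y : submodClosed H)
    (Z : submodClosed K) : Prop :=
  [/\ exists B, orthonormal_basis Y B,
      exists C, orthonormal_basis Z C
    & forall B C, orthonormal_basis Y B -> orthonormal_basis Z C -> (B #= C)%card].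

End hilbert_dimension.

(* Main.v *)
(** Put [S = T^* T = A^2] and [b = S - mu^2]: a [0,mu]-subspace is a subspace on which
    the form of [b] is nonpositive.  The projection of a maximal one, [Y], to
    [E([0,mu])H] is injective, but neither onto nor, in general, of dense range; what
    is dense is the image of [Y] under [b E([0,mu]) + E({mu})].

    Let [Y'] be maximal for [mu' < mu] and contained in [Y], and put
    [b' = S - mu'^2], [N = |b'|^(1/2)], [P' = E([0,mu'])], [Q' = 1 - P'].  By
    maximality [Y'] is the set of [x] with [N Q' x = C N P' x] for a contraction [C]
    from [P'H] to [Q'H].  With [r = N C N P'], the map [x |-> E(]mu',mu]) (b' x - r x)]
    has kernel [Y'] in [Y], and after composition with [b + E({mu})] it maps [Y] onto a
    dense subspace of [E(]mu',mu])H].  An injective bounded operator of dense range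
    between Hilbert spaces forces equal Hilbert dimensions, so the orthogonal
    complement of [Y'] in [Y] is isometric to [E(]mu',mu])H].  Part (1) is the case
    [Y' = 0], with [-1] in place of [mu'^2]. *)
Require Import Defs.
From HB Require Import structures.
From mathcomp Require Import all_boot all_order all_algebra.
From mathcomp Require Import all_classical all_reals all_analysis.
From mathcomp Require Import complex.
From mathcomp Require Import sesquilinear generic_quotient ring_quotient.
From mathcomp Require Import finmap measurable_realfun ring lra.

Import Order.TTheory GRing.Theory Num.Theory.
Import numFieldNormedType.Exports.

Local Open Scope classical_set_scope.
Local Open Scope ring_scope.
Set Implicit Arguments.
Unset Strict Implicit.
Unset Printing Implicit Defensive.
Local Open Scope complex_scope.
Local Open Scope quotient_scope.

(** No functional calculus is used: of the spectral theorem there remain the commutation of [S] with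
    two projections and the signs of [b] and [b'] on their ranges and kernels. The gap
    [mu^2 - mu'^2 > 0] supplies every inverse: [b'] is at least the gap on the kernel of
    [E([0,mu])], and [-b] is at least the gap on the range of [P'], so equations in these two spaces
    are solved by minimizing a coercive quadratic functional. On [E(]mu',mu])H] in between, neither
    [b] nor [b'] need be bounded below, since the spectrum may accumulate at both ends; hence only a
    dense range can be expected there. This suffices because the isomorphism is not sought in the
    map itself: its matrix in orthonormal bases has countably supported, independent rows and
    columns, which is enough to match the two bases, and a bijection of bases extends to an
    isometry. Neither [N] nor [C] is ever formed; [r] is built directly as a limit in [H]. *)

Lemma le_of_sqr (R : realFieldType) (p q : R) :
  0 <= q -> p ^+ 2 <= q ^+ 2 -> p <= q.
Proof. by move=> q0 pq; rewrite leNgt; apply/negP => ?; nra. Qed.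

(** * The real inner product of a complex Hilbert space *)

Section real_inner_product.
Context (R : realType) (H : hilbertType R).
Implicit Types (x y z : H) (a : R[i]) (r : R).

(** Estimates are made with this symmetric real bilinear form, whose values lie in an ordered
    field. *)
Definition rip x y : R := complex.Re (inner x y).

Lemma inner_conj x y : inner x y = (inner y x)^*%C.
Proof. by rewrite hermC expr0 mul1r. Qed.

Lemma innerDl x y z : inner (x + y) z = inner x z + inner y z.
Proof. exact: linearDl. Qed.

Lemma innerDr x y z : inner x (y + z) = inner x y + inner x z.
Proof. exact: linearDr. Qed.

Lemma innerBl x y z : inner (x - y) z = inner x z - inner y z.
Proof. exact: linearBl. Qed.

Lemma innerZl a x y : inner (a *: x) y = a * inner x y.
Proof. exact: linearZl_LR. Qed.

Lemma innerZr a x y : inner x (a *: y) = a^*%C * inner x y.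
Proof. exact: linearZr_LR. Qed.

Lemma inner0l x : inner 0 x = 0. Proof. exact: linear0l. Qed.

Lemma inner0r x : inner x 0 = 0. Proof. exact: linear0r. Qed.

Lemma inner_suml (I : Type) (s : seq I) (F : I -> H) y :
  inner (\sum_(i <- s) F i) y = \sum_(i <- s) inner (F i) y.
Proof. exact: linear_sumlz. Qed.

Lemma inner_sumr (I : Type) (s : seq I) (F : I -> H) x :
  inner x (\sum_(i <- s) F i) = \sum_(i <- s) inner x (F i).
Proof. exact: linear_sumr. Qed.

Lemma ripC x y : rip x y = rip y x.
Proof. by rewrite /rip inner_conj; case: (inner y x). Qed.

Lemma ripDl x y z : rip (x + y) z = rip x z + rip y z.
Proof. by rewrite /rip innerDl raddfD. Qed.

Lemma ripDr x y z : rip x (y + z) = rip x y + rip x z.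
Proof. by rewrite !(ripC x) ripDl. Qed.

Lemma ripNl x y : rip (- x) y = - rip x y.
Proof. by rewrite /rip linearNl raddfN. Qed.

Lemma ripNr x y : rip x (- y) = - rip x y.
Proof. by rewrite !(ripC x) ripNl. Qed.

Lemma ripBl x y z : rip (x - y) z = rip x z - rip y z.
Proof. by rewrite ripDl ripNl. Qed.

Lemma ripBr x y z : rip x (y - z) = rip x y - rip x z.
Proof. by rewrite ripDr ripNr. Qed.

Lemma rip0l x : rip 0 x = 0. Proof. by rewrite /rip inner0l. Qed.

Lemma rip0r x : rip x 0 = 0. Proof. by rewrite ripC rip0l. Qed.

Lemma ripZl r x y : rip (r%:C *: x) y = r * rip x y.
Proof.
by rewrite /rip innerZl; case: (inner x y) => u v /=; rewrite mul0r subr0.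
Qed.

Lemma ripZr r x y : rip x (r%:C *: y) = r * rip x y.
Proof. by rewrite !(ripC x) ripZl. Qed.

Lemma ripZ_conj a x y : rip (a *: x) y = rip x (a^*%C *: y).
Proof. by rewrite /rip innerZl innerZr conjcK. Qed.

Lemma complex_normE a : `|a| = (complex.Re `|a|)%:C.
Proof. by rewrite normc_def. Qed.

Lemma ripZZ a x y : rip (a *: x) (a *: y) = complex.Re `|a| ^+ 2 * rip x y.
Proof.
rewrite ripZ_conj scalerA -ripZr; congr (rip _ (_ *: _)).
by rewrite rmorphXn /= -complex_normE normCK mulrC.
Qed.

Lemma rnorm2 x : rnorm x ^+ 2 = rip x x.
Proof. by rewrite /rip -norm_inner rnormE -rmorphXn. Qed.

Lemma inner_rip x : inner x x = (rip x x)%:C.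
Proof. by rewrite -norm_inner rnormE -rmorphXn rnorm2. Qed.

Lemma rip_ge0 x : 0 <= rip x x.
Proof. by rewrite -rnorm2 sqr_ge0. Qed.

Lemma rnorm0 : rnorm (0 : H) = 0.
Proof. by rewrite /rnorm normr0. Qed.

Lemma rnorm_eq0 x : (rnorm x == 0) = (x == 0).
Proof. by rewrite -(normr_eq0 x) rnormE fmorph_eq0. Qed.

Lemma rip_eq0 x : (rip x x == 0) = (x == 0).
Proof. by rewrite -rnorm2 sqrf_eq0 rnorm_eq0. Qed.

Lemma rip_gt0 x : x != 0 -> 0 < rip x x.
Proof. by move=> x0; rewrite lt_def rip_eq0 x0 rip_ge0. Qed.

Lemma rnorm_gt0 x : x != 0 -> 0 < rnorm x.
Proof. by move=> x0; rewrite lt_def rnorm_eq0 x0 rnorm_ge0. Qed.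

Lemma rnormN x : rnorm (- x) = rnorm x.
Proof. by rewrite /rnorm normrN. Qed.

Lemma rdistC x y : rnorm (x - y) = rnorm (y - x).
Proof. by rewrite -rnormN opprB. Qed.

Lemma rnormD x y : rnorm (x + y) <= rnorm x + rnorm y.
Proof. by have := ler_normD x y; rewrite !rnormE -rmorphD lecR. Qed.

Lemma rnormZ_complex a x : rnorm (a *: x) = complex.Re `|a| * rnorm x.
Proof.
by apply: complexI; rewrite -rnormE normrZ rnormE rmorphM /= -complex_normE.
Qed.

Lemma rnormZ r x : rnorm (r%:C *: x) = `|r| * rnorm x.
Proof.
apply: complexI; rewrite -rnormE normrZ rnormE rmorphM /=; congr (_ * _).
by rewrite normc_def /= expr0n /= addr0 sqrtr_sqr.
Qed.

Lemma rnorm_le x r : 0 <= r -> (rnorm x <= r) = (rip x x <= r ^+ 2).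
Proof.
by move=> r0; rewrite -rnorm2 ler_pXn2r// ?nnegrE ?rnorm_ge0.
Qed.

Lemma rip_le x y : rip x y <= rnorm x * rnorm y.
Proof.
have [->|y0] := eqVneq y 0; first by rewrite rip0r rnorm0 mulr0.
have ny := rnorm_gt0 y0.
(* This vector has squared norm [|x|^2 |y|^2 - <x, y>^2]. *)
have := rip_ge0 ((rnorm y)%:C *: x - (rip x y / rnorm y)%:C *: y).
rewrite ripBl !ripBr !ripZl !ripZr (ripC y x) -!rnorm2 => h.
have h2 : rip x y ^+ 2 <= (rnorm x * rnorm y) ^+ 2.
  rewrite -subr_ge0; apply: le_trans h _.
  rewrite le_eqVlt; apply/orP; left; apply/eqP; field.
  exact: lt0r_neq0.
by apply: le_of_sqr h2; rewrite mulr_ge0 ?rnorm_ge0.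
Qed.

Lemma rip_normr_le x y : `|rip x y| <= rnorm x * rnorm y.
Proof.
by rewrite ler_norml rip_le andbT lerNl -ripNl -(rnormN x) rip_le.
Qed.

Lemma rip_all_eq0 x : (forall y, rip x y = 0) -> x = 0.
Proof. by move=> /(_ x)/eqP; rewrite rip_eq0 => /eqP. Qed.

(* A complex subspace contains the multiples by 'i, so real orthogonality to it
   is the same as complex orthogonality. *)
Lemma inner_eq_rip (Y : submodClosed H) x z :
  (forall y, y \in Y -> rip x y = rip z y) ->
  forall y, y \in Y -> inner x y = inner z y.
Proof.
move=> h y Yy; have := h _ Yy; have := h _ (rpredZ 'i%C Yy).
rewrite /rip !innerZr; case: (inner x y) => u v; case: (inner z y) => u' v' /=.
by rewrite !mul0r !sub0r !mulN1r !opprK => -> ->.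
Qed.

End real_inner_product.

Lemma natr_invP (R : realType) (e : R) : 0 < e ->
  exists N, forall n, (N <= n)%N -> n.+1%:R^-1 < e.
Proof.
move=> e0; exists (Num.truncn e^-1) => n Nn.
rewrite invf_plt ?posrE//; apply: lt_le_trans (truncnS_gt _) _.
by rewrite ler_nat ltnS.
Qed.

Section completeness.
Context (R : realType) (H : hilbertType R).

Definition adherent (Y : {pred H}) (x : H) :=
  forall e : R, 0 < e -> exists2 y, y \in Y & rnorm (x - y) < e.

Definition closed_subspace (Y : {pred H}) := forall x, adherent Y x -> x \in Y.

Lemma cauchy_rnorm (u : nat -> H) :
  (forall e : R, 0 < e -> exists N, forall n m, (N <= n)%N -> (N <= m)%N ->
     rnorm (u n - u m) < e) ->
  exists l, forall e : R, 0 < e -> exists N, forall n, (N <= n)%N ->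
     rnorm (l - u n) < e.
Proof.
move=> hu.
have : cauchy (u @ \oo).
  apply/cauchyP => /= e e0.
  have [r r0 re] : exists2 r : R, 0 < r & r%:C = e.
    exists (complex.Re e); first by move: e0; rewrite ltcE => /andP[].
    by move: e0; case: (e) => a b; rewrite ltcE /= => /andP[/eqP->].
  have [N hN] := hu _ r0.
  exists (u N); exists N => // n /= Nn; rewrite /= -ball_normE /= -re rnormE ltcR.
  exact: hN.
move=> /cauchy_cvgP/cvg_ex[l ul]; exists l => e e0.
have e0' : 0 < e%:C by rewrite ltcR.
have /cvgrPdist_lt/(_ _ e0')[N _ hN] := ul.
by exists N => n Nn; have /= := hN n Nn; rewrite rnormE ltcR.
Qed.

End completeness.

(** A positive [v] would satisfy [v <= v / 2] at [e = min 1 (v / (2 k))]. The restriction [e <= 1]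
    lets errors in [e^2] be absorbed into the linear bound. *)
Lemma le0_of_eps (R : realFieldType) (v k : R) :
  (forall e, 0 < e -> e <= 1 -> v <= e * k) -> v <= 0.
Proof.
move=> h; rewrite leNgt; apply/negP => v0.
have k0 : 0 < k by have := h 1 ltr01 (lexx _); rewrite mul1r; apply: lt_le_trans.
have := h (Num.min 1 (v / (2 * k))).
rewrite lt_min ltr01 divr_gt0 ?mulr_gt0// ge_min lexx => /(_ isT isT).
apply/negP; rewrite -ltNge.
apply: le_lt_trans (_ : v / (2 * k) * k < _).
  by apply: ler_wpM2r; rewrite ?ge_min ?lexx ?orbT// ltW.
have -> : v / (2 * k) * k = v / 2 by field; exact: lt0r_neq0.
by rewrite ltr_pdivrMr// ltr_pMr// ltr1n.
Qed.

(** * Variational solution of linear equations *)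

Section linear_constructions.
Context (K : numFieldType) (V W : lmodType K).

Lemma submod_of_pred (P : V -> Prop) :
  P 0 -> (forall a x y, P x -> P y -> P (a *: x + y)) ->
  exists Y : submodClosed V, forall x, x \in Y <-> P x.
Proof.
move=> P0 PD; pose Y : {pred V} := fun x => `[< P x >].
have Yc : GRing.subsemimod_closed Y.
  split; first split.
  - exact/asboolP.
  - by move=> u v /asboolP Pu /asboolP Pv; apply/asboolP; rewrite -[u]scale1r; exact: PD.
  - by move=> a u /asboolP Pu; apply/asboolP; rewrite -[_ *: _]addr0; exact: PD.
pose Ym := GRing.isSubmodClosed.Build _ _ Y Yc.
pose YS : submodClosed V := HB.pack Y Ym.
by exists YS => x; split=> [/asboolP|Px]; last exact/asboolP.
Qed.

(** Operators are constructed below from a property of their values. By linearity of the relation,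
    uniqueness of the value has to be checked at [0] only. *)
Lemma linear_of_rel (P : V -> W -> Prop) :
  (forall x, exists y, P x y) -> (forall y, P 0 y -> y = 0) ->
  (forall a x y x' y', P x x' -> P y y' -> P (a *: x + y) (a *: x' + y')) ->
  exists f : {linear V -> W}, forall x, P x (f x).
Proof.
move=> Pex P0 PD; have [f Pf] := choice Pex.
have Pu x y y' : P x y -> P x y' -> y = y'.
  move=> Py Py'; apply/eqP; rewrite -subr_eq0; apply/eqP; apply: P0.
  have := PD (-1) _ _ _ _ Py' Py.
  by rewrite !scaleN1r addNr [- y' + y]addrC.
have fl : linear f by move=> a x y; apply: Pu (Pf _) _; exact: PD.
pose fm := GRing.isLinear.Build _ _ _ _ f fl.
pose F : {linear V -> W} := HB.pack f fm.
by exists F.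
Qed.

Lemma submodB (Y : submodClosed V) x y : x \in Y -> y \in Y -> x - y \in Y.
Proof. by move=> Yx Yy; rewrite -scaleN1r rpredD// rpredZ. Qed.

End linear_constructions.

Lemma quadratic_discriminant (R : realFieldType) (c a b : R) :
  0 <= b -> (forall t, 0 <= c + 2 * t * a + t ^+ 2 * b) -> a ^+ 2 <= c * b.
Proof.
move=> b0 h; have [b1|b1] := eqVneq b 0; last first.
  have {}b0 : 0 < b by rewrite lt_def b1.
  have := h (- a / b); rewrite -(pmulr_lge0 _ b0) => {}h.
  rewrite -subr_ge0 (le_trans h)// le_eqVlt; apply/orP; left; apply/eqP.
  by field.
have [->|a0] := eqVneq a 0; first by rewrite b1 mulr0 expr0n.
(* With [b = 0] and [a] nonzero, the affine function of [t] takes the value [-1] here. *)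
have := h (- (c + 1) / (2 * a)); rewrite b1 mulr0 addr0.
have -> : c + 2 * (- (c + 1) / (2 * a)) * a = -1 by field.
lra.
Qed.

Section bounded_maps.
Context (R : realType) (H K : hilbertType R).

Definition lbounded (f : H -> K) :=
  exists2 C : R, 0 <= C & forall x, rnorm (f x) <= C * rnorm x.

Lemma lbounded_nearP (f : {linear H -> K}) :
  bounded_near f (nbhs (0 : H)) <-> lbounded f.
Proof.
rewrite linear_boundedP; split=> [/pinfty_ex_gt0[r r0 hr]|[C C0 hC]].
  exists (complex.Re r); first by move: r0; rewrite ltcE => /andP[_ /ltW].
  move=> x; have := hr x; rewrite !rnormE.
  by case: r {r0 hr} => a b; rewrite lecE /= => /andP[_]; rewrite mulr0 subr0.
near=> r => x; rewrite (@le_trans _ _ (C%:C * `|x|))//.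
  by rewrite !rnormE -rmorphM lecR.
apply: ler_wpM2r => //; near: r; apply: nbhs_pinfty_ge.
by rewrite realE lecR C0.
Unshelve. all: by end_near. Qed.

End bounded_maps.

Section symmetric_operators.
Context (R : realType) (H : hilbertType R).
Implicit Types (M : {linear H -> H}) (Y : submodClosed H).

Definition symmetric_op M := forall x y, rip (M x) y = rip x (M y).

Lemma linearZr_C M (r : R) x : M (r%:C *: x) = r%:C *: M x.
Proof. exact: linearZ. Qed.

Lemma rpredZ_C Y (r : R) x : x \in Y -> r%:C *: x \in Y.
Proof. exact: rpredZ. Qed.

Lemma psd_cauchy_schwarz M Y : symmetric_op M ->
  (forall y, y \in Y -> 0 <= rip (M y) y) ->
  forall x y, x \in Y -> y \in Y ->
  rip (M x) y ^+ 2 <= rip (M x) x * rip (M y) y.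
Proof.
move=> sM pM x y Yx Yy; apply: quadratic_discriminant; first exact: pM.
move=> t; have := pM (x + t%:C *: y) (rpredD Yx (rpredZ_C t Yy)).
rewrite linearD linearZr_C !(ripDl, ripDr) !(ripZl, ripZr) (sM y x) (ripC y).
by move=> h; apply: le_trans h _; rewrite le_eqVlt; apply/orP; left; apply/eqP; ring.
Qed.

(** Cauchy-Schwarz for the form of [M] at [x] and [M x] gives [|M x|^4 <= <M x, x> C |M x|^2]. In
    particular a null vector of the form is in the kernel of [M]. *)
Lemma psd_norm_le M Y (C : R) : symmetric_op M ->
  (forall y, y \in Y -> M y \in Y) ->
  (forall y, y \in Y -> 0 <= rip (M y) y) ->
  (forall y, rnorm (M y) <= C * rnorm y) ->
  forall x, x \in Y -> rip (M x) (M x) <= C * rip (M x) x.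
Proof.
move=> sM YM pM bM x Yx.
have := psd_cauchy_schwarz sM pM Yx (YM _ Yx).
have h : rip (M (M x)) (M x) <= C * rip (M x) (M x).
  apply: le_trans (rip_le _ _) _; rewrite -rnorm2 expr2 mulrA.
  by apply: ler_wpM2r (bM _); exact: rnorm_ge0.
have [->|/rip_gt0 p0] := eqVneq (M x) 0; first by rewrite !rip0l mulr0.
move=> h2; rewrite -(ler_pM2l p0) -expr2 (le_trans h2)//.
rewrite (le_trans (ler_wpM2l (pM _ Yx) h))// le_eqVlt; apply/orP; left.
by apply/eqP; ring.
Qed.

Section minimizing_sequence.
Variables (M : {linear H -> H}) (Y : submodClosed H) (phi : H -> R).
Hypothesis sM : symmetric_op M.
Hypothesis pM : forall y, y \in Y -> 0 <= rip (M y) y.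
Hypothesis phiD : {morph phi : x y / x + y}.
Hypothesis phiZ : forall (r : R) x, phi (r%:C *: x) = r * phi x.

(* Almost minimizers of [<M y, y> - 2 phi y] almost solve the Euler equation
   [<M u, y> = phi y], uniformly on the unit ball of the form [<M _, _>]. *)
Lemma minimizing_sequence (d : R) :
  (forall y, y \in Y -> d <= rip (M y) y - 2 * phi y) ->
  exists u : nat -> H, forall n, u n \in Y /\
    forall y, y \in Y -> (rip (M (u n)) y - phi y) ^+ 2 <= n.+1%:R^-1 * rip (M y) y.
Proof.
move=> bd; pose F y := rip (M y) y - 2 * phi y.
pose S := [set F y | y in [set` Y]].
have infS : has_inf S.
  split; first by exists (F 0), 0 => //; exact: rpred0.
  by exists d => _ [y Yy <-]; exact: bd.
have ex (n : nat) : exists u, u \in Y /\ F u < inf S + n.+1%:R^-1.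
  have e0 : 0 < n.+1%:R^-1 :> R by rewrite invr_gt0.
  have [_ [y Yy <-] lt] := inf_adherent e0 infS.
  by exists y.
have [u hu] := choice ex; exists u => n; have [Yu Fu] := hu n.
(* Comparing the functional at [u n] and at [u n + t y] gives a quadratic polynomial in [t],
   nonnegative for all [t], with constant term [1/(n+1)]. *)
split=> // y Yy; apply: quadratic_discriminant (pM Yy) _ => t.
have Yz : u n + t%:C *: y \in Y by apply: rpredD => //; exact: rpredZ_C.
have := ge_inf infS.2 (imageP F Yz).
rewrite [F _]/F linearD linearZr_C !(ripDl, ripDr) !(ripZl, ripZr) (sM y).
rewrite (ripC y) phiD phiZ => h; move: Fu h; rewrite /F.
move: (n.+1%:R^-1) (inf S) => e i Fu h; lra.
Qed.

(** Test both Euler estimates at [z = u n - u m]. If [a] and [b] are the values of [<M (u n), z>]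
    and [<M (u m), z>], then [a - b = <M z, z>] and [(a - b)^2 <= 2 (a - phi z)^2 + 2 (b - phi
    z)^2]; divide by [a - b]. The sequence is Cauchy for the form, not yet for the norm. *)
Lemma minimizing_sequence_cauchy (u : nat -> H) :
  (forall n, u n \in Y /\
    forall y, y \in Y -> (rip (M (u n)) y - phi y) ^+ 2 <= n.+1%:R^-1 * rip (M y) y) ->
  forall n m, rip (M (u n - u m)) (u n - u m) <= 2 * (n.+1%:R^-1 + m.+1%:R^-1).
Proof.
move=> hu n m; have [Yn hn] := hu n; have [Ym hm] := hu m.
have Yz : u n - u m \in Y by exact: submodB.
have -> : M (u n - u m) = M (u n) - M (u m) by rewrite linearB.
move: (hn _ Yz) (hm _ Yz) (pM Yz); rewrite linearB !ripBl.
set z := u n - u m.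
set b := rip (M (u m)) z; set a := rip (M (u n)) z; set p := phi z.
have : 0 <= n.+1%:R^-1 :> R by rewrite invr_ge0.
have : 0 <= m.+1%:R^-1 :> R by rewrite invr_ge0.
set e1 := n.+1%:R^-1; set e2 := m.+1%:R^-1 => e20 e10 ha hb ab0.
have [->|ab] := eqVneq (a - b) 0; first by rewrite mulr_ge0// addr_ge0.
have {}ab0 : 0 < a - b by rewrite lt_def ab.
rewrite -(ler_pM2r ab0).
have : 0 <= ((a - p) + (b - p)) ^+ 2 by exact: sqr_ge0.
move: ha hb; move: (e1) (e2) => e e'; lra.
Qed.

(** The solution is the limit of a minimizing sequence of [<M y, y> - 2 phi y]: coercivity turns
    Cauchy for the form into Cauchy for the norm. *)
Lemma coercive_riesz (C c D : R) : closed_subspace Y -> 0 <= C ->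
  (forall y, rnorm (M y) <= C * rnorm y) -> 0 < c ->
  (forall y, y \in Y -> c * rip y y <= rip (M y) y) ->
  0 <= D -> (forall y, y \in Y -> phi y <= D * rnorm y) ->
  exists2 g, g \in Y & forall y, y \in Y -> rip (M g) y = phi y.
Proof.
move=> cY C0 bM c0 coM D0 bphi.
have bd y : y \in Y -> - (D ^+ 2 / c) <= rip (M y) y - 2 * phi y.
  move=> Yy; have := coM _ Yy; have := bphi _ Yy; rewrite -rnorm2.
  set q := rip _ _; set p := phi y; set r := rnorm y => h1 h2.
  (* Completing the square in [r] yields the lower bound [- D^2 / c]. *)
  have : 0 <= c * (r - D / c) ^+ 2 by rewrite mulr_ge0 ?sqr_ge0 ?ltW.
  have -> : c * (r - D / c) ^+ 2 = c * r ^+ 2 - 2 * (D * r) + D ^+ 2 / c.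
    by field; exact: lt0r_neq0.
  by lra.
have [u hu] := minimizing_sequence bd.
have uC := minimizing_sequence_cauchy hu.
have [|g hg] := @cauchy_rnorm _ _ u.
  move=> e e0.
  have ce0 : 0 < c * e ^+ 2 / 4 by rewrite divr_gt0 ?mulr_gt0 ?exprn_gt0.
  have [N hN] := natr_invP ce0; exists N => n m Nn Nm.
  have := uC n m; have := hN _ Nn; have := hN _ Nm.
  have := coM _ (submodB (hu n).1 (hu m).1); rewrite -rnorm2.
  set r := rnorm _; set q := rip _ _; set e1 := n.+1%:R^-1; set e2 := m.+1%:R^-1.
  move=> h1 h2 h3 h4.
  have h5 : c * r ^+ 2 < c * e ^+ 2 by lra.
  rewrite ltNge; apply/negP => er; move: h5; rewrite ltr_pM2l// ltNge.
  by rewrite ler_pXn2r ?nnegrE ?rnorm_ge0 ?(ltW e0)// er.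
have Yg : g \in Y.
  apply: cY => e /hg[N hN]; exists (u N); first exact: (hu N).1.
  exact: hN.
exists g => // y Yy; apply/eqP; rewrite -subr_eq0 -sqrf_eq0 eq_le sqr_ge0 andbT.
(* The error is split as [<M (g - u n), y>] plus [<M (u n), y> - phi y], and its square is at most
   twice the sum of the two squares. *)
apply: (@le0_of_eps _ _ (2 * (C * rnorm y) ^+ 2 + 2 * rip (M y) y)) => e e0 e1.
have [N1 hN1] := hg _ e0; have [N2 hN2] := natr_invP e0.
pose n := maxn N1 N2; have := (hu n).2 _ Yy.
have := hN1 n (leq_maxl _ _); have := hN2 n (leq_maxr _ _).
set ee := n.+1%:R^-1 => lee ldist hn.
have : rip (M (g - u n)) y ^+ 2 <= e * (C * rnorm y) ^+ 2.
  have h1 : `|rip (M (g - u n)) y| <= e * (C * rnorm y).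
    apply: le_trans (rip_normr_le _ _) _.
    rewrite mulrA; apply: ler_wpM2r; first exact: rnorm_ge0.
    by apply: le_trans (bM _) _; rewrite mulrC; apply: ler_wpM2r => //; exact: ltW.
  rewrite -real_normK ?num_real//.
  have h2 : 0 <= C * rnorm y by rewrite mulr_ge0 ?rnorm_ge0.
  apply: le_trans (_ : (e * (C * rnorm y)) ^+ 2 <= _).
    by rewrite ler_pXn2r ?nnegrE// mulr_ge0// ltW.
  by rewrite exprMn ler_wpM2r ?sqr_ge0// expr2 ger_pMl.
rewrite linearB ripBl.
have : ee * rip (M y) y <= e * rip (M y) y by rewrite ler_wpM2r ?pM// ltW.
have : 0 <= (rip (M g) y - 2 * rip (M (u n)) y + phi y) ^+ 2 by exact: sqr_ge0.
move: hn; move: (ee) => ee'; lra.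
Qed.

End minimizing_sequence.
End symmetric_operators.

(** * Projections and maximal nonpositive subspaces *)

Section projections.
Context (R : realType) (H : hilbertType R).

Definition is_proj (p : {linear H -> H}) :=
  (forall x, p (p x) = p x) /\ symmetric_op p.

Lemma is_projP (p : {linear H -> H}) : orthogonal_projection p -> is_proj p.
Proof. by move=> [pp sp]; split=> // x y; rewrite /rip sp. Qed.

Lemma is_proj_norm_le p x : is_proj p -> rnorm (p x) <= rnorm x.
Proof.
move=> [pp sp]; have e : rip (p x) x = rip (p x) (p x) by rewrite -{1}(pp x) sp.
have := rip_ge0 (x - p x); rewrite ripBl !ripBr (ripC x (p x)) e -!rnorm2 => h.
by rewrite -(@ler_pXn2r _ 2)// ?nnegrE ?rnorm_ge0//; lra.
Qed.

Lemma is_proj_orth p x y : is_proj p -> p y = y -> rip (x - p x) y = 0.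
Proof. by move=> [pp sp] py; rewrite ripBl sp py subrr. Qed.

(** The value at [x] is the Riesz representative in [Y] of [rip x], found by [coercive_riesz] for
    the identity. Complex linearity holds because [Y] is stable under complex scalars. *)
Lemma ortho_proj (Y : submodClosed H) : closed_subspace Y ->
  exists p : {linear H -> H},
    [/\ is_proj p, forall x, p x \in Y & forall y, y \in Y -> p y = y].
Proof.
move=> cY; pose P (x p : H) := p \in Y /\ forall y, y \in Y -> rip x y = rip p y.
have P0 q : P 0 q -> q = 0.
  by move=> [Yq /(_ _ Yq)/esym/eqP]; rewrite rip0l rip_eq0 => /eqP.
have [p hp] : exists p : {linear H -> H}, forall x, P x (p x).
  apply: linear_of_rel => // [x|a x y x' y' [Yx hx] [Yy hy]].
  - have sid : symmetric_op (idfun : {linear H -> H}) by [].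
    have [|||||||||g Yg hg] := @coercive_riesz _ _ _ Y (rip x) sid _ _ _ 1 1 (rnorm x) cY.
    + by move=> y _; exact: rip_ge0.
    + by move=> y z; rewrite ripDr.
    + by move=> r y; rewrite ripZr.
    + exact: ler01.
    + by move=> y; rewrite mul1r.
    + exact: ltr01.
    + by move=> y _; rewrite mul1r.
    + exact: rnorm_ge0.
    + by move=> y _; exact: rip_le.
    by exists g; split => // y Yy; rewrite -hg.
  - split=> [|z Yz]; first by rewrite rpredD// rpredZ.
    by rewrite !ripDl !ripZ_conj hx ?hy// rpredZ.
have pid y : y \in Y -> p y = y.
  move=> Yy; apply/eqP; rewrite eq_sym -subr_eq0; apply/eqP; apply: P0.
  have [Yp hpy] := hp y; split; first exact: submodB.
  by move=> z Yz; rewrite ripBl hpy// subrr rip0l.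
exists p; split => //; last by move=> x; case: (hp x).
split=> [x|x y]; first by rewrite pid//; case: (hp x).
have [Yx hx] := hp x; have [Yy hy] := hp y.
by rewrite [RHS](hx _ Yy) ripC (hy _ Yx) ripC.
Qed.

Lemma is_proj_closed (p : {linear H -> H}) (Y : submodClosed H) :
  is_proj p -> (forall x, x \in Y <-> p x = x) -> closed_subspace Y.
Proof.
move=> pP Yp x ax; apply/Yp; apply/eqP; rewrite -subr_eq0 -rnorm_eq0 eq_le rnorm_ge0 andbT.
apply: (@le0_of_eps _ _ 2) => e e0 _.
have [y /Yp py /ltW xy] := ax _ e0.
have -> : p x - x = p (x - y) - (x - y) by rewrite linearB py opprB addrA subrK.
apply: le_trans (rnormD _ _) _; rewrite rnormN.
have := is_proj_norm_le (x - y) pP; lra.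
Qed.

End projections.

Section maximal_nonpositive.
Context (R : realType) (H : hilbertType R) (M : {linear H -> H}).
Implicit Types Y : submodClosed H.

Definition nonpos Y := forall y, y \in Y -> rip (M y) y <= 0.

Definition maxnonpos Y :=
  nonpos Y /\ forall Z : submodClosed H, nonpos Z ->
    {subset Y <= Z} -> {subset Z <= Y}.

(** By [y + a z = a (a^-1 y + z)] the form is nonpositive on the span of [Y] and [z] as soon as it
    is on [Y + z]; maximality then absorbs [z]. *)
Lemma maxnonpos_extend Y z : maxnonpos Y ->
  (forall y, y \in Y -> rip (M (y + z)) (y + z) <= 0) -> z \in Y.
Proof.
move=> [nY maxY] hz.
have [||Z hZ] := @submod_of_pred _ H (fun w => exists a y, y \in Y /\ w = y + a *: z).
- by exists 0, 0; rewrite rpred0 scale0r addr0.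
- move=> a _ _ [b [y [Yy ->]]] [c [y' [Yy' ->]]].
  exists (a * b + c), (a *: y + y'); split; first by rewrite rpredD// rpredZ.
  by rewrite scalerDr scalerDl scalerA addrACA.
apply: (maxY Z) => [w /hZ[a [y [Yy ->]]]|y Yy|].
- have [->|a0] := eqVneq a 0; first by rewrite scale0r addr0; exact: nY.
  have -> : y + a *: z = a *: (a^-1 *: y + z).
    by rewrite scalerDr scalerA divff// scale1r.
  set v := _ + z; rewrite linearZ /= ripZZ mulr_ge0_le0 ?sqr_ge0//.
  by apply: hz; rewrite rpredZ.
- by apply/hZ; exists 0, y; rewrite scale0r addr0.
- by apply/hZ; exists 1, 0; rewrite rpred0 scale1r add0r.
Qed.

Lemma maxnonpos_closed Y : symmetric_op M -> lbounded M -> maxnonpos Y ->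
  closed_subspace Y.
Proof.
move=> sM [C C0 bM] mY x ax; apply: maxnonpos_extend (mY) _ => y Yy.
set w := y + x.
apply: (@le0_of_eps _ _ (2 * C * rnorm w + C)) => e e0 e1.
have [v Yv xv] := ax _ e0; have := mY.1 (y + v) (rpredD Yy Yv).
(* With [d = x - v] small, nonpositivity at [w - d] gives [<M w, w> <= 2 <M d, w> - <M d, d>]. *)
have -> : y + v = w - (x - v) by rewrite /w opprB addrACA subrr addr0.
move: (x - v) xv => d xv; rewrite linearB !(ripBl, ripBr) (sM w d) (ripC w).
have h1 : rip (M d) w <= e * C * rnorm w.
  apply: le_trans (rip_le _ _) _; apply: ler_wpM2r; first exact: rnorm_ge0.
  by apply: le_trans (bM _) _; rewrite mulrC; apply: ler_wpM2r (ltW _).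
have h2 : - rip (M d) d <= C * e.
  rewrite -ripNr; apply: le_trans (rip_le _ _) _; rewrite rnormN.
  apply: le_trans (_ : (C * rnorm d) * rnorm d <= _).
    by apply: ler_wpM2r (bM _); exact: rnorm_ge0.
  rewrite -mulrA; apply: ler_wpM2l => //.
  have := rnorm_ge0 d; nra.
lra.
Qed.

End maximal_nonpositive.

Section positive_operators.
Context (R : realType) (H : hilbertType R) (M : {linear H -> H}).
Hypothesis sM : symmetric_op M.
Hypothesis pM : forall x, 0 <= rip (M x) x.

Definition seminorm x := Num.sqrt (rip (M x) x).

Lemma seminorm_ge0 x : 0 <= seminorm x. Proof. exact: sqrtr_ge0. Qed.

Lemma seminorm2 x : seminorm x ^+ 2 = rip (M x) x.
Proof. exact: sqr_sqrtr. Qed.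

Lemma positive_cauchy_schwarz x y : rip (M x) y ^+ 2 <= rip (M x) x * rip (M y) y.
Proof.
have [//|//|T hT] := @submod_of_pred _ H (fun=> True).
by apply: (psd_cauchy_schwarz (Y := T)) => //; apply/hT.
Qed.

Lemma rip_seminorm x y : rip (M x) y <= seminorm x * seminorm y.
Proof.
apply: le_of_sqr; first by rewrite mulr_ge0 ?seminorm_ge0.
by rewrite exprMn !seminorm2; exact: positive_cauchy_schwarz.
Qed.

Lemma positive_norm_le (C : R) : (forall y, rnorm (M y) <= C * rnorm y) ->
  forall x, rip (M x) (M x) <= C * rip (M x) x.
Proof.
move=> bM x; have [//|//|T hT] := @submod_of_pred _ H (fun=> True).
by apply: (psd_norm_le (Y := T)) => // [y _|]; apply/hT.
Qed.

End positive_operators.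

(* Let [Y] be a nonpositive subspace for [M2 - M1].  In the Hilbert spaces
   completing [H] for the forms of [M1] and [M2], [Y] is the graph of a
   contraction; extended by [0] on the orthogonal complement of its domain, it is
   a map [C].  The operator [r] of [companion_exists] is [M2 \o C]: it is bounded
   on [H] itself, and is obtained without completing [H]. *)
Section companion.
Context (R : realType) (H : hilbertType R) (M1 M2 : {linear H -> H}).
Context (Y : submodClosed H) (C1 C2 : R).
Hypotheses (s1 : symmetric_op M1) (s2 : symmetric_op M2).
Hypothesis p1 : forall x, 0 <= rip (M1 x) x.
Hypothesis p2 : forall x, 0 <= rip (M2 x) x.
Hypotheses (C10 : 0 <= C1) (C20 : 0 <= C2).
Hypothesis b1 : forall y, rnorm (M1 y) <= C1 * rnorm y.
Hypothesis b2 : forall y, rnorm (M2 y) <= C2 * rnorm y.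
Hypothesis Y12 : forall y, y \in Y -> rip (M2 y) y <= rip (M1 y) y.

Let p := seminorm M1.

(** Here [y] approximates the projection of [u] onto the closure of [Y] for the form of [M1]:
    [y - u] is almost orthogonal to [Y], one inequality being enough since [- z] is in [Y] too. The
    vector [r] is the limit of [M2 y] along such [y]. *)
Definition companion (u r : H) := forall e : R, 0 < e ->
  exists y, [/\ y \in Y, rnorm (M2 y - r) <= e &
    forall z, z \in Y -> rip (M1 (y - u)) z <= e * p z].

(** On [Y] the map [M2] is bounded for the seminorm of [M1], by
    [|M2 y|^2 <= C2 <M2 y, y> <= C2 <M1 y, y>]. So [M2 y] converges in [H] where [y] itself may
    not. *)
Let norm_M2_le y : y \in Y -> rnorm (M2 y) <= Num.sqrt C2 * p y.
Proof.
move=> Yy; apply: le_of_sqr; first by rewrite mulr_ge0 ?sqrtr_ge0.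
rewrite exprMn sqr_sqrtr// rnorm2 seminorm2//.
by apply: le_trans (positive_norm_le s2 p2 b2 y) _; apply: ler_wpM2l => //; exact: Y12.
Qed.

(** A projection does not increase [p], and [y + z] approximates the projection of [u + z], as [z]
    is in [Y]. *)
Let seminorm_near e y z u : 0 <= e -> y \in Y -> z \in Y ->
  (forall z, z \in Y -> rip (M1 (y - u)) z <= e * p z) ->
  p (y + z) <= p (u + z) + e.
Proof.
move=> e0 Yy Yz hy; have Ya := rpredD Yy Yz.
have := hy _ Ya; have := rip_seminorm s1 p1 (u + z) (y + z).
have -> : y - u = (y + z) - (u + z) by rewrite opprD addrACA subrr addr0.
rewrite linearB ripBl -(seminorm2 p1) -/p => h1 h2.
have [->|py] := eqVneq (p (y + z)) 0; first by rewrite addr_ge0 ?seminorm_ge0.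
have {}py : 0 < p (y + z) by rewrite lt_def py seminorm_ge0.
rewrite -(ler_pM2r py); move: h1 h2; rewrite -/p; lra.
Qed.

Let companion_le u r : companion u r -> rnorm r <= Num.sqrt C2 * p u.
Proof.
move=> hr; rewrite -subr_le0; apply: (@le0_of_eps _ _ (1 + Num.sqrt C2)) => e e0 _.
have [y [Yy yr hy]] := hr _ e0.
have := seminorm_near (ltW e0) Yy (rpred0 Y) hy; rewrite !addr0 => h1.
have := rnormD (M2 y) (r - M2 y); rewrite addrC subrK rdistC => h2.
have := norm_M2_le Yy; have := sqrtr_ge0 C2; nra.
Qed.

Let companion_lin a u v r r' :
  companion u r -> companion v r' -> companion (a *: u + v) (a *: r + r').
Proof.
move=> hr hr' e e0.
pose k : R := complex.Re `|a|.
have k0 : 0 <= k by rewrite -lecR -complex_normE; exact: normr_ge0.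
pose d := e / (k + 1); have k1 : 0 < k + 1 by lra.
have d0 : 0 < d by rewrite divr_gt0.
have de : k * d + d = e by rewrite /d; field; exact: lt0r_neq0.
have [y [Yy yr hy]] := hr _ d0; have [y' [Yy' yr' hy']] := hr' _ d0.
exists (a *: y + y'); split; first by rewrite rpredD// rpredZ.
- have -> : M2 (a *: y + y') - (a *: r + r') = a *: (M2 y - r) + (M2 y' - r').
    by rewrite linearP opprD addrACA scalerBr.
  apply: le_trans (rnormD _ _) _; rewrite rnormZ_complex -de lerD// ler_wpM2l//.
- move=> z Yz.
  have -> : a *: y + y' - (a *: u + v) = a *: (y - u) + (y' - v).
    by rewrite opprD addrACA scalerBr.
  rewrite linearP ripDl ripZ_conj -de mulrDl lerD ?hy'//.
  apply: le_trans (hy _ (rpredZ _ _)) _ => //.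
  rewrite /p /seminorm linearZ /= ripZZ sqrtrM ?sqr_ge0// norm_conjC sqrtr_sqr.
  by rewrite ger0_norm// mulrCA mulrA.
Qed.

(** Minimize the form of [M1] at [y - u] over [Y]; a minimizing sequence is Cauchy for [M1], hence
    its image under [M2] is Cauchy in norm. *)
Let companion_ex u : exists r, companion u r.
Proof.
have bd y : y \in Y -> - rip (M1 u) u <= rip (M1 y) y - 2 * rip (M1 u) y.
  by move=> _; have := p1 (y - u); rewrite linearB !(ripBl, ripBr) (s1 y u) (ripC y (M1 u)); lra.
have [||y hy] := @minimizing_sequence _ _ M1 Y (rip (M1 u)) s1 (fun y _ => p1 y) _ _ _ bd.
- by move=> y z; rewrite ripDr.
- by move=> c y; rewrite ripZr.
have hC := minimizing_sequence_cauchy (fun y _ => p1 y) hy.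
have [|r hr] := @cauchy_rnorm _ _ (M2 \o y).
  move=> e e0.
  have k0 : 0 < 4 * C2 + 1 by rewrite ltr_wpDl// mulr_ge0.
  (* If both errors are below this bound, then [2 C2 (e1 + e2) < e^2]; the [+ 1] covers [C2 = 0]. *)
  have ce0 : 0 < e ^+ 2 / (4 * C2 + 1) by rewrite divr_gt0 ?exprn_gt0.
  have [N hN] := natr_invP ce0; exists N => n m Nn Nm.
  have := hC n m; have := hN _ Nn; have := hN _ Nm.
  have := Y12 (submodB (hy n).1 (hy m).1).
  have := positive_norm_le s2 p2 b2 (y n - y m).
  rewrite /= -linearB -rnorm2; set r := rnorm _; set q := rip _ _; set q' := rip _ _.
  rewrite !(ltr_pdivlMr _ _ k0).
  set e1 := n.+1%:R^-1; set e2 := m.+1%:R^-1.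
  have e10 : 0 < e1 by rewrite invr_gt0.
  have e20 : 0 < e2 by rewrite invr_gt0.
  move=> h1 h2 h3 h4 h5.
  have h6 : C2 * q <= C2 * (2 * (e1 + e2)) by rewrite ler_wpM2l// (le_trans h2).
  have h7 : r ^+ 2 < e ^+ 2 by move: (e1) (e2) e10 e20 h3 h4 h6 => f f' *; lra.
  rewrite ltNge; apply/negP => er; move: h7.
  by rewrite ltNge ler_pXn2r ?nnegrE ?rnorm_ge0 ?(ltW e0)// er.
exists r => e e0.
have [N1 hN1] := hr _ e0; have [N2 hN2] := natr_invP (exprn_gt0 2 e0).
pose n := maxn N1 N2; exists (y n); have [Yn hn] := hy n; split=> //.
  by rewrite rdistC ltW// hN1// leq_maxl.
move=> z Yz; rewrite linearB ripBl; apply: le_of_sqr.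
  by rewrite mulr_ge0 ?seminorm_ge0 ?ltW.
rewrite exprMn seminorm2//; apply: le_trans (hn _ Yz) _.
by apply: ler_wpM2r => //; rewrite ltW// hN2// leq_maxr.
Qed.

Lemma companion_exists :
  exists2 r : {linear H -> H}, lbounded r & forall u, companion u (r u).
Proof.
have [||r hr] := linear_of_rel companion_ex.
- move=> y /companion_le; rewrite /p /seminorm linear0 rip0l sqrtr0 mulr0.
  by move=> y0; apply/eqP; rewrite -rnorm_eq0 eq_le y0 rnorm_ge0.
- exact: companion_lin.
exists r => //; exists (Num.sqrt C2 * Num.sqrt C1); first by rewrite mulr_ge0 ?sqrtr_ge0.
move=> x; apply: le_trans (companion_le (hr x)) _.
rewrite -mulrA; apply: ler_wpM2l; first exact: sqrtr_ge0.
apply: le_of_sqr; first by rewrite mulr_ge0 ?sqrtr_ge0 ?rnorm_ge0.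
rewrite seminorm2// exprMn sqr_sqrtr//.
apply: le_trans (rip_le _ _) _; rewrite expr2 mulrA.
by apply: ler_wpM2r (b1 _); exact: rnorm_ge0.
Qed.

Variable r : {linear H -> H}.
Hypothesis rP : forall u, companion u (r u).

Lemma companion_eq u r' : companion u r' -> r u = r'.
Proof.
move=> hr; have := companion_lin (-1) hr (rP u); rewrite !scaleN1r addNr.
move=> /companion_le; rewrite /p /seminorm linear0 rip0l sqrtr0 mulr0 => h.
apply/eqP; rewrite -subr_eq0 addrC; apply/eqP/eqP.
by rewrite -rnorm_eq0 eq_le h rnorm_ge0.
Qed.

Lemma companion_congr u v : M1 u = M1 v -> r u = r v.
Proof.
move=> uv; apply: companion_eq => e e0; have [y [Yy hy h]] := rP v e0.
by exists y; split => // z; rewrite linearB uv -linearB; exact: h.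
Qed.

Lemma companion_mem y : y \in Y -> r y = M2 y.
Proof.
move=> Yy; apply: companion_eq => e e0; exists y; rewrite !subrr rnorm0 ltW//.
by split => // z _; rewrite linear0 rip0l mulr_ge0 ?seminorm_ge0 ?ltW.
Qed.

(** [r u] is a limit of values of [M2], and [n] is continuous. *)
Lemma companion_ker (n : {linear H -> H}) u :
  (forall x, rnorm (n x) <= rnorm x) ->
  (forall y, n (M2 y) = 0) -> n (r u) = 0.
Proof.
move=> bn n0; apply/eqP; rewrite -rnorm_eq0 eq_le rnorm_ge0 andbT.
apply: (@le0_of_eps _ _ 1) => e e0 _; rewrite mulr1.
have [y [_ yr _]] := rP u e0; apply: le_trans yr.
by have := bn (M2 y - r u); rewrite linearB n0 sub0r rnormN.
Qed.

(* The point over [u] of the graph of [C] is nonpositive together with [Y]. *)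
Lemma companion_extend u x z : M2 x = r u -> z \in Y ->
  rip (M2 (x + z)) (x + z) <= rip (M1 (u + z)) (u + z).
Proof.
move=> xu Yz; rewrite -subr_le0; set g := x + z.
apply: (@le0_of_eps _ _ (2 * p (u + z) + 1 + 2 * rnorm g)) => e e0 e1.
have [y [Yy yr hy]] := rP u e0.
have h1 := seminorm_near (ltW e0) Yy Yz hy.
have h2 := Y12 (rpredD Yy Yz).
have h3 : rip (M2 (y - x)) g >= - (e * rnorm g).
  rewrite lerNl -ripNl; apply: le_trans (rip_le _ _) _; rewrite rnormN.
  by apply: ler_wpM2r; rewrite ?rnorm_ge0// linearB xu.
have h4 := p2 (y - x).
(* The vector [d = y - x] need not be small, but [M2 d] is, and [<M2 d, d>] is nonnegative. So the
   form of [M2] at [g] exceeds its value at [y + z], a point of [Y], by at most [2 e |g|]. *)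
have e2 : y + z = g + (y - x) by rewrite /g [x + z]addrC -addrA [x + _]addrC subrK addrC.
clearbody g; move: h2; rewrite -!(seminorm2 p1) -/p {1 2}e2; move: (y - x) h3 h4 => d h3 h4.
rewrite linearD !(ripDl, ripDr) (s2 g d) (ripC g (M2 d)).
have := seminorm_ge0 M1 (y + z); have := seminorm_ge0 M1 (u + z); rewrite -/p.
move: (p _) (p _) h1 => a b h1 a0 b0 h2.
have h5 : b ^+ 2 <= (a + e) ^+ 2 by rewrite ler_pXn2r ?nnegrE// addr_ge0// ltW.
have : 0 <= e * (1 - e) by rewrite mulr_ge0 ?subr_ge0// ltW.
lra.
Qed.

End companion.

Section shift_op.
Context (R : realType) (H : hilbertType R) (S : {linear H -> H}).

Definition shift_op (s : R) : {linear H -> H} := S \- (s%:C \*: idfun).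

Lemma shiftE s x : shift_op s x = S x - s%:C *: x. Proof. by []. Qed.

Lemma rip_shift s x y : rip (shift_op s x) y = rip (S x) y - s * rip x y.
Proof. by rewrite shiftE ripBl ripZl. Qed.

Lemma shift_symmetric s : symmetric_op S -> symmetric_op (shift_op s).
Proof. by move=> sS x y; rewrite [RHS]ripC !rip_shift sS (ripC x (S y)) (ripC y x). Qed.

Lemma shift_bounded s : lbounded S -> lbounded (shift_op s).
Proof.
move=> [C C0 bC]; exists (C + `|s|); first by rewrite addr_ge0.
move=> x; rewrite shiftE mulrDl; apply: le_trans (rnormD _ _) _.
by rewrite rnormN rnormZ lerD2r.
Qed.

Lemma shift_commute s (f : {linear H -> H}) :
  (forall x, f (S x) = S (f x)) -> forall x, f (shift_op s x) = shift_op s (f x).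
Proof. by move=> fS x; rewrite !shiftE linearB linearZr_C fS. Qed.

End shift_op.

(** * The map comparing two nested maximal nonpositive subspaces *)

Section relative_dimension.
Context (R : realType) (H : hilbertType R) (S P P' : {linear H -> H}) (s s' : R).
Context (Y Y' : submodClosed H).
Hypotheses (sS : symmetric_op S) (bS : lbounded S) (s's : s' < s).
Hypotheses (pP : is_proj P) (pP' : is_proj P').
Hypotheses (PP' : forall x, P (P' x) = P' x) (P'P : forall x, P' (P x) = P' x).
Hypotheses (PS : forall x, P (S x) = S (P x)) (P'S : forall x, P' (S x) = S (P' x)).
(** These signs are required of arbitrary commuting projections, not of spectral ones, so that
    [P' = 0] with [s' = -1] is an instance. *)
Hypothesis hP : forall x, P x = x -> rip (shift_op S s x) x <= 0.
Hypothesis hQ : forall x, P x = 0 -> rip (shift_op S s x) x <= 0 -> x = 0.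
Hypothesis hP' : forall x, P' x = x -> rip (shift_op S s' x) x <= 0.
Hypothesis hQ' : forall x, P' x = 0 -> rip (shift_op S s' x) x <= 0 -> x = 0.
Hypotheses (mY : maxnonpos (shift_op S s) Y) (mY' : maxnonpos (shift_op S s') Y').
Hypothesis Y'Y : {subset Y' <= Y}.

Let b := shift_op S s.
Let b' := shift_op S s'.
Let sb : symmetric_op b. Proof. exact: shift_symmetric. Qed.
Let sb' : symmetric_op b'. Proof. exact: shift_symmetric. Qed.
Let Pb x : P (b x) = b (P x). Proof. exact: shift_commute. Qed.
Let P'b x : P' (b x) = b (P' x). Proof. exact: shift_commute. Qed.
Let Pb' x : P (b' x) = b' (P x). Proof. exact: shift_commute. Qed.
Let P'b' x : P' (b' x) = b' (P' x). Proof. exact: shift_commute. Qed.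
Let bb' x : b (b' x) = b' (b x).
Proof. by apply: shift_commute => z; rewrite /b !shiftE linearB (linearZr_C S). Qed.
Let b_b' x : b x = b' x - (s - s')%:C *: x.
Proof. by rewrite !shiftE -addrA -opprD -scalerDl -rmorphD [s' + _]addrC subrK. Qed.

Let Q' : {linear H -> H} := idfun \- P'.
Let Q'E x : Q' x = x - P' x. Proof. by []. Qed.
Let pQ' : is_proj Q'.
Proof.
have [pp sp] := pP'; split=> [x|x y]; rewrite !Q'E; last by rewrite ripBl ripBr sp.
by rewrite (linearB P') pp subrr subr0.
Qed.
Let P'Q' x : P' (Q' x) = 0. Proof. by rewrite Q'E (linearB P') pP'.1 subrr. Qed.
Let Q'P' x : Q' (P' x) = 0. Proof. by rewrite Q'E pP'.1 subrr. Qed.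
Let Q'b' x : Q' (b' x) = b' (Q' x). Proof. by rewrite !Q'E P'b' (linearB b'). Qed.

(** [M1] and [M2] are the parts of [|b'|] on the ranges of [P'] and [Q'], so that [N^2 = M1 + M2]
    and [b' = M2 - M1]. *)
Let M1 : {linear H -> H} := \- (b' \o P').
Let M1E x : M1 x = - b' (P' x). Proof. by []. Qed.
Let M2 : {linear H -> H} := b' \o Q'.
Let M2E x : M2 x = b' (Q' x). Proof. by []. Qed.

Let M1P' x : rip (M1 x) x = - rip (b' (P' x)) (P' x).
Proof. by rewrite M1E ripNl -{1}pP'.1 -P'b' pP'.2. Qed.
Let M2Q' x : rip (M2 x) x = rip (b' (Q' x)) (Q' x).
Proof. by rewrite M2E -{1}pQ'.1 -Q'b' pQ'.2. Qed.

Let s1 : symmetric_op M1.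
Proof. by move=> x y; rewrite !M1E ripNl ripNr -P'b' pP'.2 sb'. Qed.
Let s2 : symmetric_op M2.
Proof. by move=> x y; rewrite !M2E -Q'b' pQ'.2 sb'. Qed.
Let p1 x : 0 <= rip (M1 x) x.
Proof. by rewrite M1P' oppr_ge0; apply: hP'; exact: pP'.1. Qed.

Let b'_ge0 x : P' x = 0 -> 0 <= rip (b' x) x.
Proof.
move=> x0; rewrite leNgt; apply/negP => h; have := hQ' x0 (ltW h).
by move=> x00; move: h; rewrite x00 rip0r ltxx.
Qed.
Let b_ge0 x : P x = 0 -> 0 <= rip (b x) x.
Proof.
move=> x0; rewrite leNgt; apply/negP => h; have := hQ x0 (ltW h).
by move=> x00; move: h; rewrite x00 rip0r ltxx.
Qed.
Let p2 x : 0 <= rip (M2 x) x.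
Proof. by rewrite M2Q'; apply: b'_ge0. Qed.

Let split_b' x : rip (b' x) x = rip (M2 x) x - rip (M1 x) x.
Proof.
rewrite M1E M2E ripNl opprK -ripDl -linearD Q'E subrK //.
Qed.

Let b1 : lbounded M1.
Proof.
have [C C0 bC] := shift_bounded s' bS; exists C => // x.
rewrite M1E rnormN; apply: le_trans (bC _) _; apply: ler_wpM2l => //.
exact: is_proj_norm_le.
Qed.
Let b2 : lbounded M2.
Proof.
have [C C0 bC] := shift_bounded s' bS; exists C => // x.
rewrite M2E; apply: le_trans (bC _) _; apply: ler_wpM2l => //.
exact: is_proj_norm_le.
Qed.

Let Y12 y : y \in Y' -> rip (M2 y) y <= rip (M1 y) y.
Proof. by move=> /mY'.1; rewrite -/b' split_b' subr_le0. Qed.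

(** As [M1] factors through [P'] and [M2] takes values in the range of [Q'], the companion of [Y']
    acts from the range of [P'] to that of [Q']. The last clause, a converse to [r y = b' (Q' y)],
    is where maximality of [Y'] enters. *)
Let rexists : exists r : {linear H -> H},
  [/\ lbounded r, forall x, r (P' x) = r x, forall x, P' (r x) = 0,
      forall y, y \in Y' -> r y = b' (Q' y) &
      forall u x, P' x = 0 -> b' x = r u -> P' u + x \in Y'].
Proof.
have [D1 D10 bD1] := b1; have [D2 D20 bD2] := b2.
have [r br hr] := companion_exists s1 s2 p1 p2 D10 D20 bD1 bD2 Y12.
have rP' x : r (P' x) = r x.
  by apply: (companion_congr s1 s2 p1 p2 D20 bD2 Y12 hr); rewrite !M1E pP'.1.
exists r; split => //.
- move=> x; apply: (companion_ker hr) => y; first exact: is_proj_norm_le.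
  by rewrite M2E P'b' P'Q' linear0.
- by move=> y Yy; rewrite (companion_mem s1 s2 p1 p2 D20 bD2 Y12 hr).
- move=> u x x0 xu; apply: maxnonpos_extend (mY') _ => z Yz; rewrite -/b'.
  have xQ : Q' x = x by rewrite Q'E x0 subr0.
  have M2x : M2 x = r (P' u) by rewrite M2E xQ rP'.
  have := companion_extend s1 s2 p1 p2 Y12 hr M2x Yz.
  rewrite split_b' subr_le0 M2Q' M1P' M2Q' M1P'.
  have -> : Q' (z + (P' u + x)) = Q' (x + z) by rewrite !linearD Q'P' add0r addrC.
  by have -> : P' (z + (P' u + x)) = P' (P' u + z) by rewrite !linearD x0 addr0 addrC.
Qed.


(** The kernel of [b] stands for the range of [E({mu})]. It lies in [Y] because adding a vector of
    it leaves the form of [b] unchanged, and [P'] kills it because [b'] is there the positive scalar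
    [s - s']. *)
Let Kexists : exists K : submodClosed H,
  [/\ closed_subspace K, forall x, x \in K <-> b x = 0, {subset K <= Y} &
      forall x, x \in K -> P x = x /\ P' x = 0].
Proof.
have [||K hK] := @submod_of_pred _ H (fun x => b x = 0).
- exact: linear0.
- by move=> a x y bx0 by0; rewrite linearP bx0 by0 scaler0 addr0.
exists K; split=> // [x ax|x /hK x0|x /hK x0].
- apply/hK/eqP; rewrite -rnorm_eq0 eq_le rnorm_ge0 andbT.
  have [C C0 bC] := shift_bounded s bS.
  apply: (@le0_of_eps _ _ C) => e e0 _; have [y /hK y0 /ltW xy] := ax _ e0.
  have -> : b x = b (x - y) by rewrite (linearB b) y0 subr0.
  by apply: le_trans (bC _) _; rewrite mulrC; apply: ler_wpM2r.
- apply: maxnonpos_extend (mY) _ => y Yy; rewrite -/b (linearD b) x0 addr0.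
  rewrite ripDr (sb y x) x0 rip0r addr0; exact: mY.1.
- split.
    apply/eqP; rewrite eq_sym -subr_eq0; apply/eqP; apply: hQ.
      by rewrite (linearB P) pP.1 subrr.
    by rewrite -/b (linearB b) -Pb x0 linear0 subrr rip0l.
  apply/eqP; rewrite -rip_eq0 eq_le rip_ge0 andbT.
  have := hP' (pP'.1 x); rewrite -/b' (_ : b' _ = (s - s')%:C *: P' x).
    by rewrite ripZl pmulr_rle0// subr_gt0.
  by apply/eqP; rewrite -subr_eq0 -b_b' -P'b x0 linear0.
Qed.

(* The map is [x |-> L ((P - P') (b' x - r x))] with [b = S - s], [b' = S - s'] and
   [L = b + E], where [E] projects onto [ker b].  Its kernel in [Y] is [Y'] because
   [b'] is onto on the kernel of [P], so that [b' x = r x] can be solved there.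
   Without the factor [L] its range would not be dense: maximality of [Y] only says
   that a vector [b t] orthogonal to [Y], with [P t = t], vanishes. *)
Lemma relative_dimension_map : exists f : {linear H -> H},
  [/\ lbounded f,
      forall x, P (f x) = f x /\ P' (f x) = 0,
      forall y, y \in Y -> f y = 0 <-> y \in Y' &
      forall w, P w = w -> P' w = 0 ->
        (forall y, y \in Y -> rip (f y) w = 0) -> w = 0].
Proof.
have [r [[Cr Cr0 br] rP' P'r rY' rext]] := rexists.
have [K [cK hK KY KP]] := Kexists.
have [E [[EE sE] EK EKid]] := ortho_proj cK.
have [PP sP] := pP; have [P'P'2 sP'] := pP'.
pose E2 : {linear H -> H} := P \- P'; pose L : {linear H -> H} := b \+ E.
have E2E x : E2 x = P x - P' x by [].
have LE x : L x = b x + E x by [].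
have E2b' x : E2 (b' x) = b' (E2 x) by rewrite !E2E Pb' P'b' (linearB b').
have PE2 x : P (E2 x) = E2 x by rewrite E2E (linearB P) PP PP'.
have P'E2 x : P' (E2 x) = 0 by rewrite E2E (linearB P') P'P P'P'2 subrr.
have sE2 : symmetric_op E2 by move=> x y; rewrite !E2E ripBl ripBr sP sP'.
have sL : symmetric_op L by move=> x y; rewrite !LE ripDl ripDr sb sE.
have PL x : P x = x -> P (L x) = L x.
  by move=> Px; rewrite LE linearD Pb Px (KP _ (EK x)).1.
have P'L x : P' x = 0 -> P' (L x) = 0.
  by move=> Px; rewrite LE linearD P'b Px (KP _ (EK x)).2 linear0 addr0.
have bE x : b (E x) = 0 by apply/hK.
(* [b] is symmetric and vanishes on [K], so the two terms of [L x] are orthogonal and vanish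
   together. *)
have L0 x : L x = 0 -> x = 0.
  move=> Lx0; have Ex0 : E x = 0.
    apply/eqP; rewrite -rip_eq0; apply/eqP.
    have : rip (L x) (E x) = 0 by rewrite Lx0 rip0l.
    by rewrite LE ripDl sb bE rip0r add0r.
  by rewrite -(EKid x)//; apply/hK; move: Lx0; rewrite LE Ex0 addr0.
have [Cb Cb0 bb] := shift_bounded s bS; have [Cb' Cb'0 bb'C] := shift_bounded s' bS.
have d0 : 0 < s - s' by rewrite subr_gt0.
pose f : {linear H -> H} := L \o (E2 \o (b' \- r)).
have fE x : f x = L (E2 (b' x - r x)) by [].
exists f; split.
- exists ((Cb + 1) * (2 * (Cb' + Cr))).
    by rewrite mulr_ge0 ?addr_ge0// mulr_ge0// addr_ge0.
  move=> x; rewrite fE.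
  have LC y : rnorm (L y) <= (Cb + 1) * rnorm y.
    rewrite LE; apply: le_trans (rnormD _ _) _; rewrite mulrDl mul1r lerD//.
    exact: is_proj_norm_le.
  apply: le_trans (LC _) _; rewrite -mulrA; apply: ler_wpM2l; first by rewrite addr_ge0.
  set z := _ - _; have zC : rnorm z <= (Cb' + Cr) * rnorm x.
    by apply: le_trans (rnormD _ _) _; rewrite rnormN mulrDl lerD.
  have := rnormD (P z) (- P' z); rewrite rnormN -E2E.
  have := is_proj_norm_le z pP; have := is_proj_norm_le z pP'; lra.
- by move=> x; rewrite fE PL ?P'L.
- move=> y Yy; split=> [|Y'y]; last first.
    by rewrite fE rY'// -(linearB b') Q'E opprB addrC subrK E2b' E2E PP' P'P'2 subrr !linear0.
  rewrite fE => /L0; rewrite (linearB E2) E2b' => /eqP; rewrite subr_eq0 => /eqP E2ry.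
  (* In [b' x = r y] the component under [E2] is solved by [E2 y]. There remains [R3], in the kernel
     of [P], where [b' = b + (s - s')] is coercive and hence attains [R3] at some [g]. *)
  pose R3 := r y - P (r y).
  have PR3 : P R3 = 0 by rewrite (linearB P) PP subrr.
  have [||Z3 hZ3] := @submod_of_pred _ H (fun x => P x = 0).
  + exact: linear0.
  + by move=> a x z x0 z0; rewrite linearP x0 z0 scaler0 addr0.
  have cZ3 : closed_subspace Z3.
    pose Q : {linear H -> H} := idfun \- P.
    apply: (@is_proj_closed _ _ Q) => [|x]; last first.
      split=> [/hZ3 x0|/eqP]; first by rewrite /Q /= x0 subr0.
      by rewrite /Q /= subr_eq addrC -subr_eq subrr eq_sym => /eqP ?; apply/hZ3.
    by split=> [x|x z]; rewrite /Q /= ?(linearB P) ?PP ?subrr ?subr0// ripBl ripBr sP.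
  have [|||||||||g /hZ3 g0 hg] := @coercive_riesz _ _ b' Z3 (rip (r y)) sb'
    _ _ _ Cb' (s - s') (rnorm (r y)) cZ3.
  + by move=> x /hZ3 x0; apply: b'_ge0; rewrite -P'P x0 linear0.
  + by move=> x z; rewrite ripDr.
  + by move=> c x; rewrite ripZr.
  + exact: Cb'0.
  + exact: bb'C.
  + exact: d0.
  + move=> x /hZ3 x0; have := b_ge0 x0; rewrite b_b' ripBl ripZl; lra.
  + exact: rnorm_ge0.
  + by move=> x _; exact: rip_le.
  have b'g : b' g = R3.
    apply/eqP; rewrite -subr_eq0 -rip_eq0; apply/eqP.
    have PD : P (b' g - R3) = 0 by rewrite (linearB P) PR3 Pb' g0 linear0 subr0.
    move: PD; set d := b' g - R3 => PD; rewrite {1}/d ripBl hg; last exact/hZ3.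
    by rewrite {1}/R3 ripBl sP PD rip0r subr0 subrr.
  have Y'x : P' y + (E2 y + g) \in Y'.
    apply: rext; first by rewrite linearD P'E2 add0r -P'P g0 linear0.
    by rewrite linearD b'g E2ry E2E P'r subr0 /R3 addrC subrK.
  have := Y'x; rewrite addrA E2E [P' y + _]addrC subrK => {}Y'x.
  (* The point [P y + g] of [Y'] differs from [y] by a vector of [Y] in the kernel of [P], where the
     form of [b] is positive definite; so it equals [y]. *)
  have Yz := submodB Yy (Y'Y Y'x).
  have Pz : P (y - (P y + g)) = 0 by rewrite (linearB P) linearD PP g0 addr0 subrr.
  by have /eqP := hQ Pz (mY.1 _ Yz); rewrite subr_eq0 => /eqP ->.
move=> w Pw P'w hw.
have [||Z1 hZ1] := @submod_of_pred _ H (fun x => P' x = x).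
+ exact: linear0.
+ by move=> a x z x0 z0; rewrite linearP x0 z0.
have cZ1 : closed_subspace Z1 by exact: is_proj_closed pP' hZ1.
pose nb : {linear H -> H} := \- b.
have nbE x : nb x = - b x by [].
have nb_co x : x \in Z1 -> (s - s') * rip x x <= rip (nb x) x.
  by move=> /hZ1 /hP'; rewrite -/b' nbE ripNl b_b' (ripBl (b' x)) ripZl; lra.
(* This replaces the adjoint of [r]: on the range of [P'] the functional [<r x, L w>] is written as
   [<- b t0, x>]. Then [<f y, w>] becomes the product of [y] with [b t + (s - s') k], where
   [t = b' w + t0]. *)
have [||||||||||t0 /hZ1 P't0 ht0] := @coercive_riesz _ _ nb Z1
  (fun x => rip (r x) (L w)) _ _ _ _ Cb (s - s') (Cr * rnorm (L w)) cZ1.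
+ by move=> x y; rewrite !nbE ripNl ripNr sb.
+ move=> x Zx; apply: le_trans (nb_co _ Zx); rewrite mulr_ge0 ?rip_ge0//; exact: ltW.
+ by move=> x z; rewrite linearD ripDl.
+ by move=> c x; rewrite linearZr_C ripZl.
+ exact: Cb0.
+ by move=> x; rewrite nbE rnormN.
+ exact: d0.
+ exact: nb_co.
+ by rewrite mulr_ge0 ?rnorm_ge0.
+ move=> x _; apply: le_trans (rip_le _ _) _.
  by rewrite mulrAC; apply: ler_wpM2r (br _); exact: rnorm_ge0.
pose k := E w; pose t := b' w + t0.
have PLw := PL _ Pw; have P'Lw := P'L _ P'w.
have Kk : k \in K by exact: EK.
have b'k : b' k = (s - s')%:C *: k by apply/eqP; rewrite -subr_eq0 -b_b' bE.
have orth y : y \in Y -> rip (b t + (s - s')%:C *: k) y = 0.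
  move=> Yy; have := hw _ Yy; rewrite fE sL sE2 E2E PLw P'Lw subr0 ripBl sb' -rP'.
  rewrite -ht0; last by apply/hZ1.
  rewrite nbE ripNl -sP' P'b P't0 opprK (ripC y) -ripDl => <-; congr (rip _ _).
  by rewrite LE (linearD b') b'k -bb' /t (linearD b) addrAC.
(* Test with [k] itself, which is in [Y] and killed by [b]: only [(s - s') |k|^2] survives. *)
have k0 : k = 0.
  have := orth _ (KY _ Kk); rewrite ripDl sb (hK _).1// rip0r add0r ripZl.
  by move=> /eqP; rewrite mulf_eq0 gt_eqF//= rip_eq0 => /eqP.
have {}orth y : y \in Y -> rip (b t) y = 0.
  by move=> /orth; rewrite k0 scaler0 addr0.
have Pt0 : P t0 = t0 by rewrite -P't0 PP'.
have Pt : P t = t by rewrite /t linearD Pb' Pw Pt0.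
(* Since [b t] is orthogonal to [Y], adding [t] to [y] changes the form only by [<b t, t>], which is
   nonpositive on the range of [P]. *)
have Yt : t \in Y.
  apply: maxnonpos_extend (mY) _ => y Yy; rewrite -/b (linearD b y t) ripDl.
  rewrite (ripDr (b y) y t) (ripDr (b t) y t) (orth _ Yy) (sb y t).
  rewrite (ripC y (b t)) (orth _ Yy) add0r addr0.
  by have := mY.1 _ Yy; have := hP Pt; rewrite -/b; lra.
have bt0 : b t = 0.
  have [||ZP hZP] := @submod_of_pred _ H (fun x => P x = x).
  - exact: linear0.
  - by move=> a x z x0 z0; rewrite linearP x0 z0.
  have snb : symmetric_op nb by move=> x y; rewrite !nbE ripNl ripNr sb.
  have : rip (nb t) (nb t) <= Cb * rip (nb t) t.
    apply: (psd_norm_le (Y := ZP)) => // [x /hZP Px|x /hZP Px|x|]; last exact/hZP.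
    - by apply/hZP; rewrite nbE linearN Pb Px.
    - by rewrite nbE ripNl oppr_ge0 hP.
    - by rewrite nbE rnormN.
  rewrite {3}nbE ripNl orth// oppr0 mulr0 nbE ripNl ripNr opprK => h.
  by apply/eqP; rewrite -rip_eq0 eq_le h rip_ge0.
have t00 : t0 = 0.
  by have [_] := KP t (proj2 (hK t) bt0); rewrite linearD P'b' P'w linear0 add0r P't0.
(* Now [b' (b w) = 0] and [P'] kills [b w], while the form of [b'] is positive definite on the
   kernel of [P']. So [w] is in [K], and [w = E w = k = 0]. *)
have bw0 : b w = 0.
  have P'bw : P' (b w) = 0 by rewrite P'b P'w linear0.
  apply: hQ' => //; rewrite -/b' -bb'; move: bt0; rewrite /t t00 addr0 => ->.
  by rewrite rip0l.
by rewrite -(EKid w)//; apply/hK.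
Qed.

End relative_dimension.

(** * Hilbert dimension *)

Section matrices_indexed_by_sets.
Context (F : fieldType).

Definition rows_free (T U : pointedType) (B : set T) (C : set U) (M : T -> U -> F) :=
  forall (s : seq T) (a : T -> F), uniq s -> (forall x, x \in s -> B x) ->
    (forall c, C c -> \sum_(x <- s) a x * M x c = 0) ->
    forall x, x \in s -> a x = 0.

(** The rows indexed by [A], cut to the finitely many columns, form a matrix with trivial left
    kernel; its rank is at most the number of columns. *)
Lemma rows_free_card (T U : pointedType) (X : set T) (Z : set U) M :
  rows_free X Z M -> finite_set Z ->
  forall A : {fset T}, [set` A] `<=` X -> (#|` A| <= #|` fset_set Z|)%N.
Proof.
move=> free fZ A AX; set t := fset_set Z.
pose D := \matrix_(i < #|` A|, j < #|` t|) M (nth point A i) (nth point t j).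
suff /eqP <- : row_free D by exact: rank_leq_col.
rewrite -kermx_eq0; apply/rowV0P => v /sub_kermxP vD; apply/rowP => i.
pose a x := \sum_(k < #|` A|) if nth point A k == x then v 0 k else 0.
have aE (k : 'I_(#|` A|)) : a (nth point A k) = v 0 k.
  rewrite /a (bigD1 k)//= eqxx big1 ?addr0// => l lk.
  by rewrite nth_uniq ?fset_uniq//; case: ifP => // /eqP/val_inj e; rewrite e eqxx in lk.
rewrite mxE -aE; apply: (free A); rewrite ?fset_uniq//; last exact: mem_nth.
move=> c Zc; have ct : c \in t by rewrite in_fset_set//; exact: mem_set.
have ci : (index c t < #|` t|)%N by rewrite index_mem.
have := congr1 (fun w : 'rV_ _ => w 0 (Ordinal ci)) vD; rewrite !mxE => vD0.
rewrite (big_nth point) big_mkord -[RHS]vD0; apply: eq_bigr => k _.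
by rewrite aE mxE /= nth_index.
Qed.

Lemma rows_free_finite (T U : pointedType) (X : set T) (Z : set U) M :
  rows_free X Z M -> finite_set Z -> finite_set X.
Proof.
move=> free fZ; apply: contrapT => /(infinite_set_fset #|` fset_set Z|.+1)[A AX].
by rewrite ltnNge (rows_free_card free fZ AX).
Qed.

Lemma rows_columns_free_countable (T U : pointedType) (X : set T) (Z : set U) M :
  countable X -> countable Z -> rows_free X Z M ->
  rows_free Z X (fun c b => M b c) -> (X #= Z)%card.
Proof.
move=> cX cZ row col; have [fZ|iZ] := pselect (finite_set Z).
  have fX := rows_free_finite row fZ; apply/fcard_eq => //; apply/eqP.
  rewrite eqn_leq (rows_free_card row fZ) ?fset_setK//=.
  by rewrite (rows_free_card col fX) ?fset_setK.
have iX : ~ finite_set X by move=> /(rows_free_finite col).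
apply: card_eq_trans (eq_card_nat cX iX) _.
by rewrite card_eq_sym; exact: eq_card_nat.
Qed.

Section components.
Context (T U : pointedType) (B : set T) (C : set U) (M : T -> U -> F).
Hypothesis countable_rows : forall b, B b -> countable [set c | C c /\ M b c != 0].
Hypothesis countable_columns : forall c, C c -> countable [set b | B b /\ M b c != 0].
Hypothesis rowB : rows_free B C M.
Hypothesis colC : rows_free C B (fun c b => M b c).

Let neighbours (X : set T) := [set c | C c /\ exists2 b, X b & M b c != 0].

Let saturated (X : set T) := forall b b' c, X b -> B b' -> C c ->
  M b c != 0 -> M b' c != 0 -> X b'.

(** The connected component of [b] among the rows, two rows being adjacent when they share a nonzero
    column. It is taken as the smallest saturated set, which avoids paths. *)
Let component b := [set b' | B b' /\ forall X, saturated X -> X b -> X b'].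

Let component_sub b : component b `<=` B. Proof. by move=> ? []. Qed.

Let component_refl b : B b -> component b b. Proof. by split. Qed.

Let component_saturated b : saturated (component b).
Proof.
move=> b1 b2 c [Bb1 h1] Bb2 Cc Mb1 Mb2; split => // X sX Xb.
exact: sX (h1 X sX Xb) Bb2 Cc Mb1 Mb2.
Qed.

(** Otherwise [component b] minus [component b'] would be a saturated set containing [b] but not
    [b']. *)
Let component_sym b b' : B b -> component b b' -> component b' b.
Proof.
move=> Bb [Bb' hb']; apply: contrapT => nb'b.
have sX : saturated (component b `\` component b').
  move=> b1 b2 c [b1b b1b'] Bb2 Cc Mb1 Mb2; split.
    exact: component_saturated b1b Bb2 Cc Mb1 Mb2.
  move=> b2b'; apply: b1b'.
  exact: component_saturated b2b' (component_sub b1b) Cc Mb2 Mb1.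
have [_] := hb' _ sX (conj (component_refl Bb) nb'b).
by apply; exact: component_refl.
Qed.

Let component_eq b b' : B b -> component b b' -> component b = component b'.
Proof.
move=> Bb bb'; have Bb' := component_sub bb'.
apply/seteqP; split => z [Bz hz]; split => // X sX Xb.
  by apply: hz => //; have [_] := component_sym Bb bb'; exact.
by apply: hz => //; case: bb' => _; exact.
Qed.

Let neighbours_countable X : X `<=` B -> countable X -> countable (neighbours X).
Proof.
move=> XB cX.
have -> : neighbours X = \bigcup_(b in X) [set c | C c /\ M b c != 0].
  apply/seteqP; split => [c [Cc [b Xb Mb]]|c [b Xb [Cc Mb]]]; first by exists b.
  by split => //; exists b.
by apply: bigcup_countable => // b Xb; apply: countable_rows; exact: XB.
Qed.

(** [X n] collects the rows reached in [n] steps. Each step adds countable unions of countable sets,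
    and the union of all [X n] is saturated. *)
Let component_countable b : B b -> countable (component b).
Proof.
move=> Bb.
pose next X := \bigcup_(c in neighbours X) [set b | B b /\ M b c != 0].
pose X := fix X n := if n is n'.+1 then next (X n') else [set b].
have XB n : X n `<=` B by case: n => [_ ->//|n b' [c _ []]].
have Xc n : countable (X n).
  elim: n => [|n IH] /=; first exact: countable1.
  apply: bigcup_countable => [|c [Cc _]]; last exact: countable_columns.
  exact: neighbours_countable.
apply: (@sub_countable _ _ _ (\bigcup_n X n)); last exact: bigcup_countable.
apply: subset_card_le => b' [_]; apply; last by exists 0%N.
move=> b1 b2 c [n _ Xb1] Bb2 Cc Mb1 Mb2; exists n.+1 => //=.
by exists c => //; split => //; exists b1.
Qed.

(* The connected components of the bipartite graph of the nonzero entries are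
   countable, so the two sides are compared one component at a time. *)
Lemma card_eq_of_matrix : (B #= C)%card.
Proof.
have cardX b : B b -> (component b #= neighbours (component b))%card.
  move=> Bb; apply: (@rows_columns_free_countable _ _ _ _ M).
  - exact: component_countable.
  - by apply: neighbours_countable (@component_sub b) _; exact: component_countable.
  (* Rows of a component vanish outside its neighbours, so cutting the columns loses no relation. *)
  - move=> s a us sX h; apply: rowB => // [x /sX/component_sub//|c Cc].
    have [|nc] := pselect (neighbours (component b) c); first exact: h.
    rewrite big_seq big1// => x /sX bx; have [->|Mx] := eqVneq (M x c) 0.
      by rewrite mulr0.
    by exfalso; apply: nc; split => //; exists x.
  - move=> s a us sZ h; apply: colC => // [c /sZ[]//|b' Bb'].
    have [|nb'] := pselect (component b b'); first exact: h.
    rewrite big_seq big1// => c /sZ[Cc [b1 bb1 Mb1]].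
    have [->|Mb'] := eqVneq (M b' c) 0; first by rewrite mulr0.
    by exfalso; apply: nb'; exact: component_saturated bb1 Bb' Cc Mb1 Mb'.
(* The bijection is chosen per component as a set, so that all rows of one component use the same
   one. *)
have [g hg] : exists g : set T -> T -> U, forall b, B b ->
    set_bij (component b) (neighbours (component b)) (g (component b)).
  have /choice[g hg] : forall X, exists h : T -> U,
      (exists2 b, B b & X = component b) -> set_bij X (neighbours X) h.
    move=> X; have [[b Bb ->]|nX] := pselect (exists2 b, B b & X = component b).
      by have /card_set_bijP[h hh] := cardX _ Bb; exists h.
    by exists (fun=> point) => /nX.
  by exists g => b Bb; apply: hg; exists b.
apply/card_set_bijP; exists (fun b => g (component b) b); split.
- move=> b Bb.
  have [fun_g _ _] := hg _ Bb.
  by have [] := fun_g _ (component_refl Bb).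
- move=> b b' /set_mem Bb /set_mem Bb' e.
  have [fun_g inj_g _] := hg _ Bb; have [fun_g' _ _] := hg _ Bb'.
  have [Cc [b1 bb1 Mb1]] := fun_g _ (component_refl Bb).
  have [_ [b2 bb2 Mb2]] := fun_g' _ (component_refl Bb').
  rewrite -e in Mb2.
  have b12 := component_saturated bb1 (component_sub bb2) Cc Mb1 Mb2.
  have eX : component b = component b'.
    by rewrite (component_eq Bb b12) (component_eq Bb' bb2).
  apply: inj_g.
  - exact/mem_set/component_refl.
  - by rewrite eX; exact/mem_set/component_refl.
  -  by rewrite e -eX.
- move=> c Cc.
  (* A zero column would be a dependent family by itself. *)
  have [b [Bb Mb]] : exists b, B b /\ M b c != 0.
    apply: contrapT => nb; have /eqP := oner_neq0 F; apply.
    apply: (colC (s := [:: c]) (a := fun=> 1)) => //; last exact: mem_head.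
      by move=> x; rewrite inE => /eqP ->.
    move=> b Bb; rewrite big_seq1 mul1r; apply/eqP/negPn/negP => Mb.
    by apply: nb; exists b.
  have [_ _ surj_g] := hg _ Bb.
  have [|b1 bb1 <-] := surj_g c.
    by split => //; exists b => //; exact: component_refl.
  by exists b1; [exact: component_sub bb1|rewrite (component_eq Bb bb1)].
Qed.

End components.
End matrices_indexed_by_sets.

Section orthonormal_bases.
Context (R : realType) (H : hilbertType R).
Implicit Types (Y : submodClosed H) (B : set H).

Lemma closureP_rnorm (A : set H) y : closure A y <->
  forall e : R, 0 < e -> exists2 z, A z & rnorm (y - z) < e.
Proof.
split=> [cA e e0|hA N /nbhs_ballP[e /= e0 yN]].
  have [|z [Az /=]] := cA (ball y e%:C); first by apply: nbhsx_ballx; rewrite ltcR.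
  by rewrite -ball_normE /= rnormE ltcR => yz; exists z.
have [r r0 re] : exists2 r : R, 0 < r & r%:C = e.
  exists (complex.Re e); first by move: e0; rewrite ltcE => /andP[].
  by move: e0; case: (e) => a b; rewrite ltcE /= => /andP[/eqP->].
have [z Az yz] := hA _ r0; exists z; split => //; apply: yN.
by rewrite -ball_normE /= -re rnormE ltcR.
Qed.

Lemma inner_eq_scale (K : hilbertType R) (x b : H) (z c : K) :
  (forall a : R[i], rip x (a *: b) = rip z (a *: c)) -> inner x b = inner z c.
Proof.
move=> h; have := h 1; have := h 'i%C; rewrite /rip !innerZr.
case: (inner x b) => u v; case: (inner z c) => u' v' /=.
by rewrite !(mul0r, mul1r, sub0r, mulN1r, opprK, oppr0, subr0) => -> ->.
Qed.

Lemma linear_span_submod B :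
  exists L : submodClosed H, forall x, x \in L <-> linear_span B x.
Proof.
apply: submod_of_pred.
  by exists 0%N, (fun=> 0), (fun=> 0); split=> [[]//|]; rewrite big_ord0.
move=> k _ _ [n [a [b [Bb ->]]]] [m [a' [b' [Bb' ->]]]].
exists (n + m)%N,
  (fun i => match fintype.split i with inl j => k * a j | inr j => a' j end),
  (fun i => match fintype.split i with inl j => b j | inr j => b' j end).
split=> [i|]; first by case: fintype.split.
rewrite big_split_ord /= scaler_sumr; congr (_ + _); apply: eq_bigr => i _.
  by rewrite (unsplitK (inl i)) scalerA.
by rewrite (unsplitK (inr i)).
Qed.

Lemma linear_span_mem B b : B b -> linear_span B b.
Proof.
move=> Bb; exists 1%N, (fun=> 1), (fun=> b); split => //.
by rewrite big_ord1 scale1r.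
Qed.

Lemma adherent_submod Y :
  exists Z : submodClosed H, (forall x, x \in Z <-> adherent Y x) /\ closed_subspace Z.
Proof.
have [||Z hZ] := @submod_of_pred _ H (adherent Y).
- by move=> e e0; exists 0; rewrite ?rpred0// subrr rnorm0.
- move=> a x y hx hy e e0.
  pose k := complex.Re `|a|.
  have k0 : 0 <= k by rewrite -lecR -complex_normE; exact: normr_ge0.
  have k1 : 0 < k + 1 by rewrite ltr_wpDl.
  have d0 : 0 < e / (k + 1) by rewrite divr_gt0.
  have [x' Yx' xx'] := hx _ d0; have [y' Yy' yy'] := hy _ d0.
  exists (a *: x' + y'); first by rewrite rpredD// rpredZ.
  rewrite opprD addrACA -scalerBr; apply: le_lt_trans (rnormD _ _) _.
  rewrite rnormZ_complex -/k.
  have -> : e = k * (e / (k + 1)) + e / (k + 1) by field; exact: lt0r_neq0.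
  by apply: ler_ltD => //; apply: ler_wpM2l => //; exact: ltW.
exists Z; split => // x ax; apply/hZ => e e0.
have e20 : 0 < e / 2 by rewrite divr_gt0.
have [y /hZ Zy xy] := ax _ e20; have [z Yz yz] := Zy _ e20.
exists z => //; have -> : x - z = (x - y) + (y - z) by rewrite addrA subrK.
by apply: le_lt_trans (rnormD _ _) _; lra.
Qed.

Lemma orthonormal_basis_eq0 Y B x : orthonormal_basis Y B -> x \in Y ->
  (forall b, B b -> inner x b = 0) -> x = 0.
Proof.
move=> [_ _ cB] /cB/closureP_rnorm ax xB; apply/eqP; rewrite -rip_eq0 eq_le rip_ge0 andbT.
apply: (@le0_of_eps _ _ (rnorm x)) => e e0 _.
have [_ [n [a [b [Bb ->]]]] /ltW xe] := ax _ e0.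
rewrite -[X in rip X _](subrK (\sum_i a i *: b i)) ripDl.
rewrite (_ : rip (\sum_i _) x = 0).
  rewrite addr0; apply: le_trans (rip_le _ _) _.
  by apply: ler_wpM2r xe; exact: rnorm_ge0.
rewrite ripC /rip inner_sumr big1// => i _.
by rewrite innerZr xB ?mulr0.
Qed.

Lemma orthonormal_basis_eq Y B x y : orthonormal_basis Y B -> x \in Y ->
  y \in Y -> (forall b, B b -> inner x b = inner y b) -> x = y.
Proof.
move=> oB Yx Yy xy; apply/eqP; rewrite -subr_eq0; apply/eqP.
apply: orthonormal_basis_eq0 oB (submodB Yx Yy) _ => b Bb.
by rewrite innerBl xy// subrr.
Qed.

(** Some combination of finitely many basis vectors, the set [F n], is within [1/(n+1)] of [x], so
    basis vectors outside [F n] have a coefficient at most that large. Those outside every [F n] are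
    orthogonal to [x]. *)
Lemma orthonormal_support_countable Y B x : orthonormal_basis Y B -> x \in Y ->
  countable [set b | B b /\ inner x b != 0].
Proof.
move=> [_ oB cB] /cB/closureP_rnorm ax.
have /choice[F hF] : forall n : nat, exists F : set H, finite_set F /\
    forall b a, B b -> ~ F b -> rip x (a *: b) <= n.+1%:R^-1 * rnorm (a *: b).
  move=> n; have e0 : 0 < n.+1%:R^-1 :> R by rewrite invr_gt0.
  have [_ [m [a [v [Bv ->]]]] /ltW xe] := ax _ e0.
  exists [set v i | i in [set: 'I_m]]; split; first exact: finite_image.
  move=> b k Bb nb; rewrite -[X in rip X _](subrK (\sum_i a i *: v i)) ripDl.
  rewrite (_ : rip (\sum_i _) _ = 0).
    rewrite addr0; apply: le_trans (rip_le _ _) _.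
    by apply: ler_wpM2r xe; exact: rnorm_ge0.
  rewrite /rip inner_suml big1// => i _; rewrite innerZl innerZr oB//.
  have [vb|_] := eqVneq (v i) b; last by rewrite !mulr0.
  by exfalso; apply: nb; exists i.
apply: (@sub_countable _ _ _ (\bigcup_n F n)); last first.
  by apply: bigcup_countable => // n _; apply: finite_set_countable; case: (hF n).
apply: subset_card_le => b [Bb xb]; apply: contrapT => nFb.
have rle a : rip x (a *: b) <= 0.
  apply: (@le0_of_eps _ _ (rnorm (a *: b))) => e e0 _.
  have [N hN] := natr_invP e0; have [_ h] := hF N.
  apply: le_trans (h _ a Bb _) _; first by move=> FNb; apply: nFb; exists N.
  by apply: ler_wpM2r; [exact: rnorm_ge0|exact: ltW (hN _ _)].
move/eqP: xb; apply; rewrite -(inner0l b); apply: inner_eq_scale => a.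
rewrite rip0l; apply/eqP; rewrite eq_le rle/=.
by have := rle (- a); rewrite scaleNr ripNr oppr_le0.
Qed.

Lemma orthonormal_coef B (s : seq H) (a : H -> R[i]) :
  (forall x y, B x -> B y -> inner x y = (x == y)%:R) ->
  uniq s -> (forall x, x \in s -> B x) ->
  \sum_(x <- s) a x *: x = 0 -> forall x, x \in s -> a x = 0.
Proof.
move=> oB us sB s0 x xs; have := congr1 (fun y => inner y x) s0.
rewrite inner0l inner_suml (bigD1_seq x)//=.
rewrite innerZl (oB _ _ (sB _ xs) (sB _ xs)) eqxx mulr1.
rewrite big_seq_cond big1 ?addr0// => y /andP[ys yx].
by rewrite innerZl (oB _ _ (sB _ ys) (sB _ xs)) (negbTE yx) mulr0.
Qed.

(** A maximal orthonormal subset exists by Zorn. If its closed span missed [y], the normalized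
    component of [y] orthogonal to that span would enlarge it. *)
Lemma orthonormal_basis_exists Y : closed_subspace Y ->
  exists B, orthonormal_basis Y B.
Proof.
move=> cY.
pose P (B : set H) := (forall x, B x -> x \in Y) /\
  (forall x y, B x -> B y -> inner x y = (x == y)%:R).
have [F FP totF|B [[BY oB] maxB]] := @Zorn_bigcup H P.
  split=> [x [X FX Xx]|x y [X FX Xx] [X' FX' X'y]]; first exact: (FP _ FX).1.
  have [XX'|X'X] := totF _ _ FX FX'.
    by apply: (FP _ FX').2 => //; exact: XX'.
  by apply: (FP _ FX).2 => //; exact: X'X.
exists B; split => // y Yy; apply/closureP_rnorm.
have [L hL] := linear_span_submod B.
suff : adherent L y by move=> h e /h[z /hL]; exists z.
have [Z [hZ cZ]] := adherent_submod L.
have [p [pP pZ pid]] := ortho_proj cZ.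
have LZ x : x \in L -> x \in Z.
  by move=> Lx; apply/hZ => e e0; exists x => //; rewrite subrr rnorm0.
have LY x : x \in L -> x \in Y.
  by move=> /hL[n [a [b [Bb ->]]]]; apply: rpred_sum => i _; rewrite rpredZ// BY.
have ZY x : x \in Z -> x \in Y.
  by move=> /hZ ax; apply: cY => e /ax[z /LY]; exists z.
have [yp|yp] := eqVneq (y - p y) 0.
  by apply/hZ; move/eqP: yp; rewrite subr_eq0 => /eqP ->.
exfalso; pose u := (rnorm (y - p y))^-1%:C *: (y - p y).
have n0 := rnorm_gt0 yp.
have uu : inner u u = 1.
  rewrite inner_rip /u ripZl ripZr -rnorm2 -[RHS]/(1%:C); congr (_%:C).
  by field; exact: lt0r_neq0.
have uZ z : z \in Z -> inner u z = 0.
  rewrite -[RHS](inner0l z) => Zz; apply: (inner_eq_rip (Y := Z)) => // t Zt.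
  by rewrite /u ripZl (is_proj_orth y pP (pid _ Zt)) mulr0 rip0l.
have BZ b : B b -> b \in Z by move=> Bb; apply/LZ/hL/linear_span_mem.
have nBu : ~ B u.
  by move=> /BZ/uZ; rewrite uu => /eqP; rewrite oner_eq0.
apply: (maxB (B `|` [set u])).
  by split; [exact: subsetUl|move=> /(_ u); apply: contra_not nBu; apply; right].
split=> [x [/BY//|->]|x z].
  by rewrite /u rpredZ// submodB// ZY.
move=> [Bx|->] [Bz|->]; first exact: oB.
- rewrite inner_conj uZ ?BZ// conjc0; case: eqP => // e.
  by exfalso; apply: nBu; rewrite -e.
- rewrite uZ ?BZ//; case: eqP => // e.
  by exfalso; apply: nBu; rewrite e.
- by rewrite uu eqxx.
Qed.

End orthonormal_bases.

Section hilbert_dimension.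
Context (R : realType) (H K : hilbertType R).
Context (Y : submodClosed H) (W : submodClosed K) (f : {linear H -> K}).
Hypotheses (cY : closed_subspace Y) (bf : lbounded f).
Hypothesis fW : forall y, y \in Y -> f y \in W.
Hypothesis f_inj : forall y, y \in Y -> f y = 0 -> y = 0.
Hypothesis f_dense : forall w, w \in W ->
  (forall y, y \in Y -> rip (f y) w = 0) -> w = 0.
Context (B : set H) (C : set K).
Hypotheses (oB : orthonormal_basis Y B) (oC : orthonormal_basis W C).

Let BY b : B b -> b \in Y. Proof. by case: oB => h _ _; exact: h. Qed.
Let CW c : C c -> c \in W. Proof. by case: oC => h _ _; exact: h. Qed.

Let adjoint_on w : exists2 g, g \in Y &
  forall y, y \in Y -> inner (f y) w = inner y g.
Proof.
have [D D0 bD] := bf.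
have sid : symmetric_op (idfun : {linear H -> H}) by [].
have [|||||||||g Yg hg] := @coercive_riesz _ _ _ Y (fun y => rip (f y) w) sid
  _ _ _ 1 1 (D * rnorm w) cY.
- by move=> y _; exact: rip_ge0.
- by move=> x y; rewrite linearD ripDl.
- by move=> r x; rewrite linearZ_LR /= ripZl.
- exact: ler01.
- by move=> y; rewrite mul1r.
- exact: ltr01.
- by move=> y _; rewrite mul1r.
- by rewrite mulr_ge0 ?rnorm_ge0.
- move=> y _; apply: le_trans (rip_le _ _) _; rewrite mulrAC.
  by apply: ler_wpM2r (bD _); exact: rnorm_ge0.
exists g => // y Yy; rewrite inner_conj [RHS]inner_conj; congr (_^*%C).
apply: inner_eq_scale => a; rewrite ripC [RHS]ripC (ripC _ g).
by rewrite (hg _ (rpredZ a Yy)) linearZ.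
Qed.

(** The matrix is [<f b, c>]. Its rows and columns have countable support as coefficients of [f b]
    and of the adjoint at [c]; injectivity of [f] makes the rows independent, density of its range
    the columns. *)
Lemma hilbert_dimension_eq : (B #= C)%card.
Proof.
apply: (@card_eq_of_matrix _ _ _ B C (fun b c => inner (f b) c)).
- move=> b Bb; apply: orthonormal_support_countable oC _.
  by apply: fW; exact: BY.
- move=> c Cc; have [g Yg hg] := adjoint_on c.
  apply: sub_countable (orthonormal_support_countable oB Yg).
  apply: subset_card_le => b [Bb]; rewrite hg ?BY// => bg; split => //.
  by apply: contraNneq bg => gb; rewrite inner_conj gb conjc0.
- move=> s a us sB h; case: oB => _ oB' _.
  apply: (orthonormal_coef oB') => //.
  have Yz : \sum_(x <- s) a x *: x \in Y.
    by rewrite big_seq; apply: rpred_sum => x xs; apply/rpredZ/BY/sB.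
  apply: f_inj => //; apply: orthonormal_basis_eq0 oC (fW Yz) _ => c Cc.
  rewrite linear_sum inner_suml -[RHS](h c Cc); apply: eq_bigr => x _.
  by rewrite linearZ innerZl.
(* The product is conjugate linear in its second argument, so a relation between columns concerns
   the combination with conjugated coefficients. *)
- move=> s a us sC h x xs.
  suff : (a x)^*%C = 0 by move=> /(congr1 conjc); rewrite conjcK conjc0.
  case: oC => _ oC' _; apply: (orthonormal_coef (a := fun c => (a c)^*%C) oC' us) => //.
  have Wz : \sum_(c <- s) (a c)^*%C *: c \in W.
    by rewrite big_seq; apply: rpred_sum => c cs; apply/rpredZ/CW/sC.
  apply: f_dense => // y Yy; have [g Yg hg] := adjoint_on (\sum_(c <- s) (a c)^*%C *: c).
  rewrite /rip hg// (_ : g = 0) ?inner0r//.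
  apply: orthonormal_basis_eq0 oB Yg _ => b Bb.
  rewrite inner_conj -hg ?BY// inner_sumr.
  under eq_bigr do rewrite innerZr conjcK.
  by rewrite h ?conjc0.
Qed.

End hilbert_dimension.

(** * Isometries from bijections of orthonormal bases *)

Section basis_bijection.
Context (R : realType) (H K : hilbertType R).
Context (Y : submodClosed H) (W : submodClosed K).
Hypotheses (cY : closed_subspace Y) (cW : closed_subspace W).
Context (B : set H) (C : set K) (phi : H -> K).
Hypotheses (oB : orthonormal_basis Y B) (oC : orthonormal_basis W C).
Hypothesis phiB : set_bij B C phi.

Let BY b : B b -> b \in Y. Proof. by case: oB => h _ _; exact: h. Qed.
Let CW c : C c -> c \in W. Proof. by case: oC => h _ _; exact: h. Qed.
Let phiC b : B b -> C (phi b). Proof. by case: phiB => h _ _; exact: h. Qed.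

Let transfer x z := z \in W /\ forall b, B b -> inner z (phi b) = inner x b.

Let transfer_unique x z z' : transfer x z -> transfer x z' -> z = z'.
Proof.
move=> [Wz hz] [Wz' hz']; apply: orthonormal_basis_eq oC Wz Wz' _ => c Cc.
by case: phiB => _ _ /(_ c Cc)[b Bb <-]; rewrite hz// hz'.
Qed.

Let transfer_lin a x y x' y' :
  transfer x x' -> transfer y y' -> transfer (a *: x + y) (a *: x' + y').
Proof.
move=> [Wx hx] [Wy hy]; split; first by rewrite rpredD// rpredZ.
by move=> b Bb; rewrite !innerDl !innerZl hx// hy.
Qed.

Let transfer_span x : linear_span B x ->
  exists2 z, transfer x z & rip z z = rip x x.
Proof.
move=> [n [a [v [Bv ->]]]]; pose z := \sum_i a i *: phi (v i).
have Tz : transfer (\sum_i a i *: v i) z.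
  split=> [|b Bb]; first by apply: rpred_sum => i _; apply/rpredZ/CW/phiC.
  rewrite !inner_suml; apply: eq_bigr => i _; rewrite !innerZl; congr (_ * _).
  have [_ oB' _] := oB; have [_ oC' _] := oC.
  rewrite (oB' _ _ (Bv i) Bb) (oC' _ _ (phiC (Bv i)) (phiC Bb)).
  case: phiB => _ inj_phi _; congr (_%:R); congr (nat_of_bool _).
  by apply/eqP/eqP => [/inj_phi|-> //]; apply; exact: mem_set.
exists z => //; rewrite /rip; congr (complex.Re _).
rewrite {2}/z !inner_sumr; apply: eq_bigr => i _.
by rewrite !innerZr; congr (_ * _); case: Tz => _ ->.
Qed.

Let transfer_norm x z : linear_span B x -> transfer x z -> rnorm z = rnorm x.
Proof.
move=> /transfer_span[z' Tz' nz'] Tz; rewrite (transfer_unique Tz Tz').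
apply/eqP; rewrite -(@eqrXn2 _ 2)// ?rnorm_ge0//.
by rewrite !rnorm2 nz'.
Qed.

(** The projection of [x] is approximated by finite combinations of [B]; transfer is isometric on
    these, so their images form a Cauchy sequence. *)
Let transfer_ex x : exists2 z, transfer x z & rnorm z <= rnorm x.
Proof.
have [p [pP pY pid]] := ortho_proj cY.
have [L hL] := linear_span_submod B.
have inner_p b : B b -> inner x b = inner (p x) b.
  move=> Bb; apply: (inner_eq_rip (Y := Y)) => [y Yy|]; last exact: BY.
  by rewrite pP.2 pid.
case: (oB) => _ _ /(_ _ (pY x))/closureP_rnorm ax.
have /choice[u hu] : forall n : nat, exists uz : H * K,
    [/\ linear_span B uz.1, transfer uz.1 uz.2 & rnorm (p x - uz.1) < n.+1%:R^-1].
  move=> n; have e0 : 0 < n.+1%:R^-1 :> R by rewrite invr_gt0.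
  have [v Bv xv] := ax _ e0; have [z Tz _] := transfer_span Bv.
  by exists (v, z).
have nE n m : rnorm ((u n).2 - (u m).2) = rnorm ((u n).1 - (u m).1).
  have [Bn Tn _] := hu n; have [Bm Tm _] := hu m.
  apply: transfer_norm; first by apply/hL/submodB; apply/hL.
  by have := transfer_lin (-1) Tm Tn; rewrite !scaleN1r ![- _ + _]addrC.
have [|z hz] := @cauchy_rnorm _ _ (snd \o u).
  move=> e e0; have e20 : 0 < e / 2 by rewrite divr_gt0.
  have [N hN] := natr_invP e20; exists N => n m Nn Nm; rewrite /= nE.
  have [_ _ hn] := hu n; have [_ _ hm] := hu m.
  have := hN _ Nn; have := hN _ Nm; move: hn hm.
  set e1 := n.+1%:R^-1; set e2 := m.+1%:R^-1 => hn hm h2 h1.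
  have -> : (u n).1 - (u m).1 = (p x - (u m).1) - (p x - (u n).1).
    by rewrite opprB addrACA addrC addrA subrK addrC.
  apply: le_lt_trans (rnormD _ _) _; rewrite rnormN; lra.
have near e : 0 < e -> exists n, rnorm (z - (u n).2) <= e /\ rnorm (p x - (u n).1) <= e.
  move=> e0; have [N1 hN1] := hz _ e0; have [N2 hN2] := natr_invP e0.
  exists (maxn N1 N2); split; first by apply: ltW; apply: hN1; exact: leq_maxl.
  have [_ _ hn] := hu (maxn N1 N2); apply: ltW; apply: lt_trans hn _.
  by apply: hN2; exact: leq_maxr.
exists z.
- split=> [|b Bb].
    apply: cW => e e0; have e20 : 0 < e / 2 by rewrite divr_gt0.
    have [n [hn _]] := near _ e20; exists (u n).2; first by have [_ []] := hu n.
    by apply: le_lt_trans hn _; lra.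
  rewrite inner_p//; apply: inner_eq_scale => a.
  apply/eqP; rewrite -subr_eq0 -normr_le0.
  apply: (@le0_of_eps _ _ (rnorm (a *: phi b) + rnorm (a *: b))) => e e0 _.
  have [n [hn1 hn2]] := near _ e0; have [_ [_ Tn] _] := hu n.
  have e1 : rip (u n).2 (a *: phi b) = rip (u n).1 (a *: b).
    by rewrite /rip !innerZr Tn.
  have -> : rip z (a *: phi b) - rip (p x) (a *: b) =
      rip (z - (u n).2) (a *: phi b) - rip (p x - (u n).1) (a *: b).
    by rewrite !ripBl e1; ring.
  apply: le_trans (ler_normB _ _) _; rewrite mulrDr lerD//.
    apply: le_trans (rip_normr_le _ _) _; apply: ler_wpM2r => //; exact: rnorm_ge0.
  apply: le_trans (rip_normr_le _ _) _; apply: ler_wpM2r => //; exact: rnorm_ge0.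
- apply: le_trans (is_proj_norm_le x pP); rewrite -subr_le0.
  apply: (@le0_of_eps _ _ 2) => e e0 _; have [n [hn1 hn2]] := near _ e0.
  have [Bn Tn _] := hu n.
  have := rnormD (z - (u n).2) (u n).2; rewrite subrK (transfer_norm Bn Tn).
  have := rnormD ((u n).1 - p x) (p x); rewrite subrK rdistC; lra.
Qed.

Lemma basis_bijection_map : exists f : {linear H -> K},
  [/\ lbounded f, forall x, f x \in W &
      forall x b, B b -> inner (f x) (phi b) = inner x b].
Proof.
have [|||f hf] := @linear_of_rel _ _ _ transfer.
- by move=> x; have [z] := transfer_ex x; exists z.
- move=> z Tz; apply: transfer_unique Tz _; split; first exact: rpred0.
  by move=> b _; rewrite !inner0l.
- exact: transfer_lin.
exists f; split => [|x|x b Bb]; [|by case: (hf x)|by case: (hf x) => _ ->].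
exists 1 => // x; rewrite mul1r; have [z Tz] := transfer_ex x.
by rewrite (transfer_unique (hf x) Tz).
Qed.

End basis_bijection.

Lemma orthonormal_basis_isometry (R : realType) (H K : hilbertType R)
    (Y : submodClosed H) (W : submodClosed K) (B : set H) (C : set K) :
  closed_subspace Y -> closed_subspace W ->
  orthonormal_basis Y B -> orthonormal_basis W C -> (B #= C)%card ->
  exists (f : {linear H -> K}) (g : {linear K -> H}),
    [/\ lbounded f, lbounded g, (forall x, f x \in W), (forall z, g z \in Y) &
        (forall y, y \in Y -> g (f y) = y) /\ (forall w, w \in W -> f (g w) = w)].
Proof.
move=> cY cW oB oC /card_set_bijP[phi phiB].
have [fun_phi inj_phi surj_phi] := phiB.
have /choice[psi hpsi] : forall c, exists b, C c -> B b /\ phi b = c.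
  move=> c; have [Cc|nC] := pselect (C c); last by exists 0.
  by have [b Bb bc] := surj_phi c Cc; exists b.
have psiK b : B b -> psi (phi b) = b.
  move=> Bb; have [Bp pE] := hpsi _ (fun_phi _ Bb).
  by apply: inj_phi => //; exact: mem_set.
have psiC : set_bij C B psi.
  split=> [c /hpsi[]//|c c' /set_mem Cc /set_mem Cc' e|b Bb].
  - by rewrite -(hpsi _ Cc).2 -(hpsi _ Cc').2 e.
  - by exists (phi b); [exact: fun_phi|exact: psiK].
have [f [bf fW hf]] := basis_bijection_map cY cW oB oC phiB.
have [g [bg gY hg]] := basis_bijection_map cW cY oC oB psiC.
exists f, g; split => //; split=> [y Yy|w Ww].
- apply: orthonormal_basis_eq oB (gY _) Yy _ => b Bb.
  by rewrite -{1}(psiK b Bb) hg ?hf//; exact: fun_phi.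
- apply: orthonormal_basis_eq oC (fW _) Ww _ => c Cc.
  have [Bp {1}<-] := hpsi _ Cc; rewrite hf//.
  by rewrite hg.
Qed.

(** * Isomorphisms of subspaces and quotients *)

Section isomorphisms.
Context (R : realType) (H K : hilbertType R).
Context (Y Y' : submodClosed H) (W : submodClosed K).
Context (f : {linear H -> K}) (g : {linear K -> H}).
Hypotheses (bf : lbounded f) (bg : lbounded g).
Hypotheses (fW : forall x, f x \in W) (gY : forall z, g z \in Y).
Hypothesis fgK : forall w, w \in W -> f (g w) = w.

Let cf : continuous f.
Proof. exact/bounded_linear_continuous/lbounded_nearP. Qed.
Let cg : continuous g.
Proof. exact/bounded_linear_continuous/lbounded_nearP. Qed.

Let F (y : subsp Y) : subsp W := Sub (f (val y)) (fW _).
Let G (w : subsp W) : subsp Y := Sub (g (val w)) (gY _).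

Let cont_F : continuous F.
Proof.
apply: continuous_comp_initial => y.
apply: (@continuous_comp _ _ _ (val : subsp Y -> H) f); last exact: cf.
exact: initial_continuous.
Qed.

Let cont_G : continuous G.
Proof.
apply: continuous_comp_initial => w.
apply: (@continuous_comp _ _ _ (val : subsp W -> K) g); last exact: cg.
exact: initial_continuous.
Qed.

Let lin_F : linear F.
Proof. by move=> a x y; apply: val_inj; rewrite /= linearP. Qed.

Lemma isomorphic_subsp :
  (forall y, y \in Y -> g (f y) = y) -> isomorphic (subsp Y) (subsp W).
Proof.
move=> gfK; pose Fm := GRing.isLinear.Build _ _ _ _ F lin_F.
pose FL : {linear subsp Y -> subsp W} := HB.pack F Fm.
exists FL, G; split => //.
- by move=> y; apply: val_inj; rewrite /= gfK//; exact: (valP y).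
- by move=> w; apply: val_inj; rewrite /= fgK//; exact: (valP w).
Qed.

(** The map induced by [f] is continuous by the universal property of the quotient topology, and its
    inverse is [g] followed by the quotient map. *)
Lemma isomorphic_quotsp :
  (forall y, y \in Y' -> f y = 0) ->
  (forall y, y \in Y -> g (f y) - y \in Y') ->
  isomorphic (quotsp (subsp_in Y Y')) (subsp W).
Proof.
move=> f0 gfK.
pose Q := Quotient.quot (zmod_of_submod (subsp_in Y Y')).
pose q (y : subsp Y) : quotsp (subsp_in Y Y') := \pi_Q y.
have qK u : q (repr (u : Q)) = u by rewrite /q reprK.
pose h (u : quotsp (subsp_in Y Y')) : subsp W := F (repr (u : Q)).
have hq y : h (q y) = F y.
  have /quotsp_eqP qy := qK (q y).
  apply: val_inj; apply/eqP; rewrite /= -subr_eq0 -linearB.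
  by rewrite f0//; exact: qy.
have lin_h : linear h.
  move=> a u v; rewrite -(qK u) -(qK v); move: (repr _) (repr _) => x y.
  rewrite !hq -lin_F -hq; congr h.
  by rewrite /q -quotsp_add_pi -quotsp_scale_pi.
pose hm := GRing.isLinear.Build _ _ _ _ h lin_h.
pose hL : {linear quotsp (subsp_in Y Y') -> subsp W} := HB.pack h hm.
exists hL, (q \o G); split.
- move=> u; rewrite /= -[RHS]qK; apply/quotsp_eqP.
  by apply: gfK; exact: (valP (repr (u : Q))).
- by move=> w; rewrite /= hq; apply: val_inj; rewrite /= fgK//; exact: (valP w).
- apply/quotient_continuous; rewrite (_ : _ \o _ = F); first exact: cont_F.
  by apply/funext => y; exact: hq.
- move=> w; apply: continuous_comp; first exact: cont_G.
  exact: pi_continuous.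
Qed.

End isomorphisms.

(** * The spectral subspaces of [A] *)

(** The form is real at [x], [y] and [x + i y]; the imaginary part at the last is
    [Re <A y, x> - Re <A x, y>]. *)
Lemma positive_symmetric (R : realType) (H : hilbertType R) (A : {linear H -> H}) :
  (forall x, 0 <= inner (A x) x) -> symmetric_op A.
Proof.
move=> pA x y; rewrite (ripC x).
have im0 z : complex.Im (inner (A z) z) = 0.
  by have := pA z; case: (inner (A z) z) => a b; rewrite lecE /= => /andP[/eqP].
have := im0 (x + 'i%C *: y); have := im0 x; have := im0 y.
rewrite linearD linearZ /= !(innerDl, innerDr) !innerZl !innerZr /rip.
case: (inner (A x) x) (inner (A x) y) (inner (A y) x) (inner (A y) y) => [a b] [c d] [e f] [g h] /=.
by lra.
Qed.

Section halfline_intervals.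
Context (R : realType).

Lemma itv_oc_halfline (a b : R) : 0 <= a -> `]a, b]%classic `<=` @halfline R.
Proof.
move=> a0 x; rewrite /halfline /= !in_itv /= andbT.
by move=> /andP[/ltW/(le_trans a0)].
Qed.

Lemma itv_cc_halfline (b : R) : `[0, b]%classic `<=` @halfline R.
Proof. by move=> x; rewrite /halfline /= !in_itv /= andbT => /andP[]. Qed.

Lemma itv_oy_halfline (a : R) : 0 <= a -> `]a, +oo[%classic `<=` @halfline R.
Proof.
by move=> a0 x; rewrite /halfline /= !in_itv /= !andbT => /ltW/(le_trans a0).
Qed.

Lemma halfline_split (a : R) : 0 <= a ->
  @halfline R = `[0, a]%classic `|` `]a, +oo[%classic.
Proof.
move=> a0; apply/seteqP; split=> x; rewrite /halfline /= !in_itv /= !andbT.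
  by move=> x0; case: (leP x a) => xa; [left; rewrite x0|right].
by case=> [/andP[]//|/ltW/(le_trans a0)].
Qed.

Lemma halfline_disjoint (a : R) : `[0, a]%classic `&` `]a, +oo[%classic = set0.
Proof.
apply/seteqP; split=> x //= []; rewrite !in_itv /= andbT => /andP[_ xa].
by rewrite ltNge xa.
Qed.

End halfline_intervals.

Section spectral.
Context (R : realType) (H : hilbertType R) (E : pvm H).
Implicit Types (B C : set R) (x y : H).

Lemma pvm_is_proj B : measurable B -> B `<=` @halfline R -> is_proj (E B).
Proof. by move=> mB sB; apply: is_projP; exact: pvm_orthogonal_projection. Qed.

Lemma spectral_measure_sub B x : B `<=` @halfline R ->
  spectral_measure E x B = (rip (E B x) (E B x))%:E.
Proof. by move=> sB; rewrite /spectral_measure (setIidl sB) rnorm2. Qed.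

Lemma pvm_setU_norm B C x : measurable B -> measurable C ->
  B `<=` @halfline R -> C `<=` @halfline R -> B `&` C = set0 ->
  rip (E (B `|` C) x) (E (B `|` C) x) = rip (E B x) (E B x) + rip (E C x) (E C x).
Proof.
move=> mB mC sB sC BC.
have : spectral_measure E x (B `|` C) =
    (spectral_measure E x B + spectral_measure E x C)%E by exact: measureU.
rewrite !spectral_measure_sub//; last by move=> z [/sB|/sC].
by rewrite -EFinD => -[].
Qed.

Lemma pvm_orth B C x : measurable B -> B `<=` @halfline R ->
  measurable C -> C `<=` @halfline R ->
  B `&` C = set0 -> E B x = x -> E C x = 0.
Proof.
by move=> mB sB mC sC BC <-; rewrite -pvm_setI// setIC BC pvm_set0.
Qed.

Lemma pvm_setU_id B C x : measurable B -> measurable C ->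
  B `<=` @halfline R -> C `<=` @halfline R -> B `&` C = set0 ->
  E (B `|` C) x = x -> E B x = 0 -> E C x = x.
Proof.
move=> mB mC sB sC BC Ux Bx; have [PP sP] := pvm_is_proj mC sC.
have := pvm_setU_norm x mB mC sB sC BC; rewrite Ux Bx rip0l add0r => e.
apply/eqP; rewrite eq_sym -subr_eq0 -rip_eq0.
have e2 : rip (E C x) x = rip (E C x) (E C x) by rewrite -{1}PP sP.
by rewrite ripBl !ripBr (ripC x (E C x)) e2 -e !subrr.
Qed.

Context (A : {linear H -> H}).
Hypotheses (sA : symmetric_op A) (EA : spectral_integral E A).

Let rip_integral x :
  (rip (A x) x)%:E = (\int[spectral_measure E x]_(l in @halfline R) l%:E)%E.
Proof.
have [iA eA] := EA x; rewrite /rip eA /Rintegral /= fineK//.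
apply: integrable_fin_num iA; exact: measurable_itv.
Qed.

(* If [E B u = u] and [E B v = 0], the spectral measures of [u + v] and [u - v]
   coincide, so the form of [A] takes the same value at both. *)
Lemma pvm_commute B x : measurable B -> B `<=` @halfline R ->
  E B (A x) = A (E B x).
Proof.
move=> mB sB; have [PP sP] := pvm_is_proj mB sB.
have orth u v : E B u = u -> E B v = 0 -> rip (A u) v = 0.
  move=> Bu Bv; have : rip (A (u + v)) (u + v) = rip (A (u - v)) (u - v).
    apply: EFin_inj; rewrite !rip_integral; apply: eq_measure_integral => C mC sC.
    rewrite -[LHS]/(spectral_measure E (u + v) C) -[RHS]/(spectral_measure E (u - v) C).
    rewrite !spectral_measure_sub//; congr (_%:E).
    have h : rip (E C u) (E C v) = 0.
      rewrite -Bu -pvm_setI// setIC pvm_setI// sP -pvm_setI// setIC pvm_setI// Bv.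
      by rewrite linear0 rip0r.
    rewrite linearD (linearB (E C)) !(ripDl, ripDr, ripNl, ripNr) (ripC (E C v) (E C u)) h; ring.
  rewrite linearD (linearB A) !(ripDl, ripDr, ripNl, ripNr) (sA v u) (ripC v); lra.
have h1 : E B (A (x - E B x)) = 0.
  apply: rip_all_eq0 => z; rewrite sP sA ripC sA; rewrite -sA; apply: orth.
    by rewrite PP.
  by rewrite (linearB (E B)) PP subrr.
have h2 : A (E B x) - E B (A (E B x)) = 0.
  apply: rip_all_eq0 => z; rewrite ripBl sP -ripBr; apply: orth => //.
  by rewrite (linearB (E B)) PP subrr.
move/eqP: h2; rewrite subr_eq0 => /eqP ->.
by apply/eqP; rewrite -subr_eq0 -!(linearB (E B)) -linearB h1.
Qed.

Lemma pvm_form_le (mu : R) x : 0 <= mu -> E `[0, mu]%classic x = x ->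
  rip (A x) x <= mu * rip x x.
Proof.
move=> mu0 Px; rewrite -lee_fin rip_integral.
have mP : measurable `[0, mu]%classic by exact: measurable_itv.
have mQ : measurable `]mu, +oo[%classic by exact: measurable_itv.
have [iA _] := EA x.
rewrite (negligible_integral mQ _ iA); last 2 first.
- exact: measurable_itv.
- rewrite -[LHS]/(spectral_measure E x `]mu, +oo[%classic) spectral_measure_sub;
    last exact: itv_oy_halfline.
  rewrite (@pvm_orth `[0, mu]%classic) ?rip0l//.
  + exact: itv_cc_halfline.
  + exact: itv_oy_halfline.
  + exact: halfline_disjoint.
rewrite (halfline_split mu0) setDUl setDv setU0 setDidl; last exact: halfline_disjoint.
pose m : {measure set R -> \bar R} := spectral_measure E x.
apply: (@le_trans _ _ (\int[m]_(l in `[0%R, mu]) (cst mu%:E l))%E).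
  apply: ge0_le_integral => //=.
  - by move=> l; rewrite in_itv /= lee_fin => /andP[].
  - by move=> l; rewrite in_itv /= lee_fin => /andP[].
rewrite integral_cst// -[X in (_ * X)%E]/(spectral_measure E x `[0, mu]%classic).
by rewrite spectral_measure_sub ?Px//; exact: itv_cc_halfline.
Qed.

(** The measure of [x] lives on []mu,+oo[], and there the integral of the positive function [l - mu]
    is at most [0]. So this set is null, and its measure is [|x|^2]. *)
Lemma pvm_form_gt (mu : R) x : 0 <= mu -> E `[0, mu]%classic x = 0 ->
  rip (A x) x <= mu * rip x x -> x = 0.
Proof.
move=> mu0 Px; rewrite -lee_fin rip_integral.
have mP : measurable `[0, mu]%classic by exact: measurable_itv.
have mQ : measurable `]mu, +oo[%classic by exact: measurable_itv.
have [iA _] := EA x.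
rewrite (negligible_integral mP _ iA); last 2 first.
- exact: measurable_itv.
- rewrite -[LHS]/(spectral_measure E x `[0, mu]%classic) spectral_measure_sub ?Px ?rip0l//.
  exact: itv_cc_halfline.
rewrite (halfline_split mu0) setUC setDUl setDv setU0 setDidl;
  last by rewrite setIC halfline_disjoint.
have Qx : E `]mu, +oo[%classic x = x.
  apply: (@pvm_setU_id `[0, mu]%classic) => //.
  - exact: itv_cc_halfline.
  - exact: itv_oy_halfline.
  - exact: halfline_disjoint.
  - by rewrite -halfline_split// pvm_setT.
set D := `]mu, +oo[%classic.
pose m : {measure set R -> \bar R} := spectral_measure E x.
have mD : m D = (rip x x)%:E.
  rewrite -[LHS]/(spectral_measure E x D) spectral_measure_sub ?Qx//.
  exact: itv_oy_halfline.
have mf : measurable_fun D (fun l : R => (l - mu)%:E).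
  by apply/measurable_EFinP; apply: measurable_funB.
have f0 l : D l -> (0 <= (l - mu)%:E)%E.
  by rewrite /D /= in_itv /= andbT lee_fin subr_ge0 => /ltW.
rewrite (_ : (\int[_]_(l in D) l%:E)%E =
    (\int[m]_(l in D) (cst mu%:E l + (l - mu)%:E))%E); last first.
  by apply: eq_integral => l _; rewrite /= -EFinD addrC subrK.
rewrite ge0_integralD//=.
rewrite integral_cst// mD -EFinM => h.
have int0 : (\int[m]_(l in D) `|(l - mu)%:E| = 0)%E.
  rewrite (_ : (\int[m]_(l in D) `|(l - mu)%:E| = \int[m]_(l in D) (l - mu)%:E)%E); last first.
    by apply: eq_integral => l /set_mem Dl; rewrite gee0_abs//; exact: f0.
  apply/eqP; rewrite eq_le integral_ge0// andbT.
  by move: h; rewrite -[leRHS]adde0 leeD2lE.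
have [N [mN N0 DN]] := (ae_eq_integral_abs m mQ mf).1 int0.
have : (m D <= m N)%E.
  apply: (le_measure m); [exact: mem_set|exact: mem_set|move=> l Dl].
  apply: DN => /= /(_ Dl)[/eqP]; rewrite subr_eq0.
  by move: Dl; rewrite /D /= in_itv /= andbT; case: ltgtP.
rewrite N0 mD lee_fin => xx0; apply/eqP; rewrite -rip_eq0 eq_le rip_ge0.
by rewrite xx0.
Qed.

End spectral.

Section maximal_interval_subspaces.
Context (R : realType) (H K : hilbertType R) (S : {linear H -> H}) (f : {linear H -> K}).
Hypothesis fS : forall x, rip (f x) (f x) = rip (S x) x.

Lemma maximal_interval_subspaceP (mu : R) (Y : submodClosed H) : 0 <= mu ->
  (* Both [T] and [A] are instances of [f], so the two notions of subspace reduce to one condition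
     on [S]. *)
  maximal_interval_subspace f `[0, mu] Y <-> maxnonpos (shift_op S (mu ^+ 2)) Y.
Proof.
move=> mu0.
have nonposP Z : interval_subspace f `[0, mu] Z <-> nonpos (shift_op S (mu ^+ 2)) Z.
  have h x : x != 0 -> (rnorm (f x) / rnorm x \in `[0, mu]) =
      (rip (shift_op S (mu ^+ 2) x) x <= 0).
    move=> x0; have nx := rnorm_gt0 x0.
    rewrite in_itv /= divr_ge0 ?rnorm_ge0//= ler_pdivrMr//.
    rewrite rnorm_le ?mulr_ge0 ?rnorm_ge0// fS exprMn rnorm2.
    by rewrite rip_shift subr_le0.
  split=> [hZ x Zx|hZ x Zx x0]; last by rewrite h// hZ.
  have [->|x0] := eqVneq x 0; first by rewrite rip0r.
  by rewrite -h//; exact: hZ.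
split=> -[nY mY]; split; first by apply/nonposP.
- by move=> Z /nonposP; exact: mY.
- by apply/nonposP.
- by move=> Z /nonposP; exact: mY.
Qed.

End maximal_interval_subspaces.

Lemma lbounded_comp (R : realType) (H K L : hilbertType R) (f : K -> L) (g : H -> K) :
  lbounded f -> lbounded g -> lbounded (f \o g).
Proof.
move=> [C C0 bC] [D D0 bD]; exists (C * D); first exact: mulr_ge0.
move=> x; apply: le_trans (bC _) _; rewrite -mulrA; exact: ler_wpM2l.
Qed.

Lemma lrangeP (R : realType) (H : hilbertType R) (p : {linear H -> H}) x :
  is_proj p -> x \in lrange p <-> p x = x.
Proof.
move=> [pp _]; split=> [/asboolP[y <-]|px]; first exact: pp.
by apply/asboolP; exists x.
Qed.

(** * Dimension, isomorphism and quotients of the maximal subspaces *)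

Section corollary.
Context (R : realType) (H : hilbertType R) (A : {linear H -> H}) (E : pvm H).
Hypotheses (bA : lbounded A) (pA : forall x, 0 <= inner (A x) x).
Hypothesis EA : spectral_integral E A.

Let S : {linear H -> H} := A \o A.
Let sA : symmetric_op A := positive_symmetric pA.
Let SE x : S x = A (A x). Proof. by []. Qed.
Let ripS x : rip (S x) x = rip (A x) (A x). Proof. by rewrite SE sA. Qed.
Let sS : symmetric_op S. Proof. by move=> x y; rewrite !SE !sA. Qed.
Let bS : lbounded S. Proof. exact: lbounded_comp. Qed.

Let P (mu : R) := E `[0, mu]%classic.
Let pP mu : is_proj (P mu).
Proof. apply: pvm_is_proj; [exact: measurable_itv|exact: itv_cc_halfline]. Qed.
Let PA mu x : P mu (A x) = A (P mu x).
Proof. by apply: pvm_commute => //; exact: itv_cc_halfline. Qed.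
Let PS mu x : P mu (S x) = S (P mu x). Proof. by rewrite !SE !PA. Qed.

(** As [A x] is in the range of [P mu] too, Cauchy-Schwarz for the form of [A] gives [|A x|^4 <= <A
    x, x> <A (A x), A x> <= mu |x|^2 mu |A x|^2]. *)
Let norm_A_le mu x : 0 <= mu -> P mu x = x -> rip (shift_op S (mu ^+ 2) x) x <= 0.
Proof.
move=> mu0 Px; rewrite rip_shift subr_le0 ripS.
have pA' y : 0 <= rip (A y) y by have := pA y; rewrite lecE => /andP[].
have := positive_cauchy_schwarz sA pA' x (A x).
have := pvm_form_le EA mu0 Px; have := @pvm_form_le _ _ _ _ EA mu (A x) mu0.
rewrite PA Px => /(_ erefl); have := pA' x; have := pA' (A x); have := rip_ge0 x.
set a := rip (A (A x)) _; set b := rip (A x) x; set c := rip (A x) (A x).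
have : 0 <= c by exact: rip_ge0.
move: (rip x x) => n c0 n0 a0 b0 ha hb h.
have [->|cn0] := eqVneq c 0; first by rewrite mulr_ge0 ?sqr_ge0.
have {}c0 : 0 < c by rewrite lt_def cn0.
rewrite -(ler_pM2r c0) -expr2; apply: le_trans h _.
apply: le_trans (ler_pM b0 a0 hb ha) _.
by rewrite le_eqVlt; apply/orP; left; apply/eqP; ring.
Qed.

Let norm_A_gt mu x : 0 <= mu -> P mu x = 0 -> rip (shift_op S (mu ^+ 2) x) x <= 0 -> x = 0.
Proof.
move=> mu0 Px; rewrite rip_shift subr_le0 ripS -!rnorm2 -exprMn => h.
apply: (pvm_form_gt EA mu0 Px); apply: le_trans (rip_le _ _) _.
rewrite -rnorm2 expr2 mulrA; apply: ler_wpM2r; first exact: rnorm_ge0.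
by apply: le_of_sqr => //; rewrite mulr_ge0 ?rnorm_ge0.
Qed.

Let lrange_P mu x : x \in lrange (P mu) <-> P mu x = x.
Proof. exact: lrangeP. Qed.

Let closed_lrange_P mu : closed_subspace (lrange (P mu)).
Proof. exact: is_proj_closed (pP mu) (@lrange_P mu). Qed.

Let maxnonposS_closed mu Y : maxnonpos (shift_op S mu) Y -> closed_subspace Y.
Proof.
by apply: maxnonpos_closed; [exact: shift_symmetric sS|exact: shift_bounded bS].
Qed.

Lemma maxnonpos_dimension (mu : R) (Y : submodClosed H) B C : 0 <= mu ->
  maxnonpos (shift_op S (mu ^+ 2)) Y ->
  orthonormal_basis Y B -> orthonormal_basis (lrange (P mu)) C -> (B #= C)%card.
Proof.
move=> mu0 mY oB oC.
(* The zero subspace is the maximal one at the level [-1]. *)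
have [//||O hO] := @submod_of_pred _ H (fun x => x = 0).
  by move=> a x y -> ->; rewrite scaler0 addr0.
have neg x : rip (shift_op S (-1) x) x <= 0 -> x = 0.
  rewrite rip_shift mulN1r opprK ripS => h; apply/eqP; rewrite -rip_eq0 eq_le rip_ge0 andbT.
  by have := rip_ge0 (A x); lra.
have zero : is_proj (\0 : {linear H -> H}).
  by split=> [//|x y]; rewrite rip0l rip0r.
have mO : maxnonpos (shift_op S (-1)) O.
  split=> [x /hO -> |Z nZ _ x /nZ/neg ->]; first by rewrite rip0r.
  exact: rpred0.
have s's : -1 < mu ^+ 2 by apply: lt_le_trans (sqr_ge0 mu); rewrite ltrN10.
have [|//|||||f [bf fP fY fd]] := @relative_dimension_map _ _ S (P mu) \0 (mu ^+ 2) (-1) Y O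
  sS bS s's (pP mu) zero _ _ (PS mu) _ (fun x => @norm_A_le mu x mu0)
  (fun x => @norm_A_gt mu x mu0) _ _ mY mO.
- by move=> x; exact: linear0.
- by move=> x; rewrite linear0.
- by move=> x <-; rewrite rip0r.
- by move=> x _; exact: neg.
- by move=> x /hO ->; exact: rpred0.
apply: (@hilbert_dimension_eq _ _ _ Y (lrange (P mu)) f) => //.
- exact: maxnonposS_closed mY.
- by move=> y Yy; apply/lrange_P; case: (fP y).
- by move=> y Yy fy0; apply/hO/fY.
- by move=> w /lrange_P Pw; apply: fd.
Qed.

Lemma maxnonpos_isomorphic (mu : R) (Y : submodClosed H) : 0 <= mu ->
  maxnonpos (shift_op S (mu ^+ 2)) Y ->
  isomorphic (subsp Y) (subsp (lrange (P mu))) /\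
  same_hilbert_dim Y (lrange (P mu)).
Proof.
move=> mu0 mY; have cY := maxnonposS_closed mY.
have cW : closed_subspace (lrange (P mu)) by exact: closed_lrange_P.
have [B oB] := orthonormal_basis_exists cY; have [C oC] := orthonormal_basis_exists cW.
have BC := maxnonpos_dimension mu0 mY oB oC.
have [f [g [bf bg fW gY [gfK fgK]]]] := orthonormal_basis_isometry cY cW oB oC BC.
split; first exact: isomorphic_subsp bf bg fW gY fgK gfK.
by split; [exists B|exists C|move=> B' C'; exact: maxnonpos_dimension].
Qed.

Lemma maxnonpos_isomorphic2 (mu : R) (Y1 Y2 : submodClosed H) : 0 <= mu ->
  maxnonpos (shift_op S (mu ^+ 2)) Y1 -> maxnonpos (shift_op S (mu ^+ 2)) Y2 ->
  isomorphic (subsp Y1) (subsp Y2) /\ same_hilbert_dim Y1 Y2.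
Proof.
move=> mu0 mY1 mY2; have c1 := maxnonposS_closed mY1; have c2 := maxnonposS_closed mY2.
have [C oC] := orthonormal_basis_exists (@closed_lrange_P mu).
have card12 B1 B2 : orthonormal_basis Y1 B1 -> orthonormal_basis Y2 B2 -> (B1 #= B2)%card.
  move=> o1 o2; apply: card_eq_trans (maxnonpos_dimension mu0 mY1 o1 oC) _.
  by rewrite card_eq_sym; exact: maxnonpos_dimension mY2 o2 oC.
have [B1 o1] := orthonormal_basis_exists c1; have [B2 o2] := orthonormal_basis_exists c2.
have [f [g [bf bg fW gY [gfK fgK]]]] :=
  orthonormal_basis_isometry c1 c2 o1 o2 (card12 _ _ o1 o2).
split; first exact: isomorphic_subsp bf bg fW gY fgK gfK.
by split; [exists B1|exists B2|exact: card12].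
Qed.

Lemma maxnonpos_quotient (mu mu' : R) (Y Y' : submodClosed H) :
  0 <= mu' -> mu' <= mu -> maxnonpos (shift_op S (mu ^+ 2)) Y ->
  maxnonpos (shift_op S (mu' ^+ 2)) Y' -> {subset Y' <= Y} ->
  isomorphic (quotsp (subsp_in Y Y')) (subsp (lrange (E `]mu', mu]%classic))).
Proof.
(* For [mu' = mu] there is no gap, but then maximality of [Y'] gives [Y' = Y] and both sides are
   zero spaces. *)
move=> mu'0; rewrite le_eqVlt => /orP[/eqP <-|mu'mu] mY mY' Y'Y.
  have YY' := mY'.2 Y mY.1 Y'Y.
  have b0 : lbounded (\0 : {linear H -> H}).
    by exists 0 => // x; rewrite rnorm0 mul0r.
  apply: (@isomorphic_quotsp _ _ _ Y Y' _ \0 \0) => //=.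
  - by move=> _; exact: rpred0.
  - by move=> _; exact: rpred0.
  - by move=> w /asboolP[x <-]; rewrite set_itvE pvm_set0.
  - by move=> y /YY' Yy; rewrite sub0r -scaleN1r rpredZ.
have mu0 : 0 <= mu by apply: le_trans (ltW mu'mu).
pose W := E `]mu', mu]%classic.
have mP' : measurable `[0, mu']%classic by exact: measurable_itv.
have mW : measurable `]mu', mu]%classic by exact: measurable_itv.
have sW := @itv_oc_halfline _ mu' mu mu'0.
have UW : `[0, mu]%classic = `[0, mu']%classic `|` `]mu', mu]%classic.
  apply/seteqP; split=> x /=; rewrite !in_itv /=.
    by move=> /andP[x0 xmu]; case: (leP x mu') => xm; [left; rewrite x0|right].
  case=> /andP[x0 xmu]; first by rewrite x0 (le_trans xmu)// ltW.
  by rewrite xmu andbT (le_trans mu'0)// ltW.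
have IW : `[0, mu']%classic `&` `]mu', mu]%classic = set0.
  apply/seteqP; split=> x //= []; rewrite !in_itv /= => /andP[_ h1] /andP[h2 _].
  by move: h2; rewrite ltNge h1.
have pW : is_proj W by exact: pvm_is_proj.
have WP x : W x = x <-> P mu x = x /\ P mu' x = 0.
  split=> [Wx|[Px P'x]].
    split; last first.
      apply: (pvm_orth mW sW mP' _ _ Wx); first exact: itv_cc_halfline.
      by rewrite setIC.
    rewrite -Wx -pvm_setI//; last exact: itv_cc_halfline.
    by rewrite UW setIUl IW set0U setIid.
  apply: (pvm_setU_id mP' mW _ sW IW) P'x; first exact: itv_cc_halfline.
  by rewrite -UW.
have PP' x : P mu (P mu' x) = P mu' x.
  rewrite -pvm_setI//; try exact: itv_cc_halfline.
  by rewrite UW setIUl setIid [_ `&` `[0, mu']%classic]setIC IW setU0.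
have P'P x : P mu' (P mu x) = P mu' x.
  rewrite -pvm_setI//; try exact: itv_cc_halfline.
  by rewrite UW setIUr setIid IW setU0.
have s's : mu' ^+ 2 < mu ^+ 2 by rewrite ltr_pXn2r ?nnegrE.
have [f [bf fP fY fd]] := @relative_dimension_map _ _ S (P mu) (P mu') (mu ^+ 2) (mu' ^+ 2) Y Y'
  sS bS s's (pP mu) (pP mu') PP' P'P (PS mu) (PS mu')
  (fun x => @norm_A_le mu x mu0) (fun x => @norm_A_gt mu x mu0)
  (fun x => @norm_A_le mu' x mu'0) (fun x => @norm_A_gt mu' x mu'0) mY mY' Y'Y.
have cY := maxnonposS_closed mY; have cY' := maxnonposS_closed mY'.
have [p [pp pY' pid]] := ortho_proj cY'.
have [||Z hZ] := @submod_of_pred _ H (fun x => x \in Y /\ p x = 0).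
- by rewrite rpred0 linear0.
- move=> a x y [Yx px] [Yy py]; split; first by rewrite rpredD// rpredZ.
  by rewrite linearP px py scaler0 addr0.
have cZ : closed_subspace Z.
  move=> x ax; apply/hZ; split.
    by apply: cY => e /ax[z /hZ[Yz _] xz]; exists z.
  apply/eqP; rewrite -rnorm_eq0 eq_le rnorm_ge0 andbT.
  apply: (@le0_of_eps _ _ 1) => e e0 _; have [z /hZ[_ pz] xz] := ax _ e0.
  rewrite mulr1; have := is_proj_norm_le (x - z) pp; rewrite linearB pz subr0 => h.
  exact: le_trans h (ltW xz).
have YZ y : y \in Y -> y - p y \in Z.
  move=> Yy; apply/hZ; split; first exact: submodB Yy (Y'Y _ (pY' y)).
  by rewrite linearB pp.1 subrr.
have hW x : x \in lrange W <-> W x = x by exact: lrangeP.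
have cW : closed_subspace (lrange W) by exact: is_proj_closed pW hW.
have [B oB] := orthonormal_basis_exists cZ; have [C oC] := orthonormal_basis_exists cW.
have BC : (B #= C)%card.
  apply: (@hilbert_dimension_eq _ _ _ Z (lrange W) f) => //.
  - by move=> z _; apply/hW/WP.
  - move=> z /hZ[Yz pz] /(fY _ Yz) Y'z.
    by rewrite -(pid _ Y'z).
  - move=> w /hW/WP[Pw P'w] orth; apply: fd => // y Yy.
    rewrite -(orth _ (YZ _ Yy)); congr (rip _ _).
    by rewrite linearB (proj2 (fY _ (Y'Y _ (pY' y))) (pY' y)) subr0.
have [F [G [bF bG FW GZ [GFK FGK]]]] := orthonormal_basis_isometry cZ cW oB oC BC.
(* On [Y] the kernel of [q] is [Y'], and [G] is a right inverse of [q] with values in the complement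
   [Z], so [q] induces the isomorphism from the quotient. *)
pose q : {linear H -> H} := F \o (idfun \- p).
have qE x : q x = F (x - p x) by [].
apply: (@isomorphic_quotsp _ _ _ Y Y' _ q G) => //.
- apply: lbounded_comp bF _; exists 2 => // x /=.
  have := rnormD x (- p x); have := is_proj_norm_le x pp; rewrite rnormN; lra.
- by move=> x; rewrite qE.
- by move=> w; have /hZ[] := GZ w.
- by move=> w Ww; have /hZ[_ pG] := GZ w; rewrite qE pG subr0 FGK.
- by move=> y Y'y; rewrite qE pid// subrr linear0.
- move=> y Yy; rewrite qE GFK ?YZ// addrC addrA addNr sub0r -scaleN1r rpredZ//.
Qed.

End corollary.

Theorem corollary7 (R : realType) (H H' : hilbertType R)
    (T : {linear H -> H'}) (Ts : {linear H' -> H}) (A : {linear H -> H})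
    (E : pvm H) :
  bounded_near T (nbhs (0 : H)) ->
  adjoint T Ts ->
  positive_sqrt A (Ts \o T) ->
  spectral_integral E A ->
  (forall mu : R, 0 <= mu ->
     [/\ forall Y : submodClosed H,
           maximal_interval_subspace T `[0, mu] Y <->
           maximal_interval_subspace A `[0, mu] Y,
         forall Y1 Y2 : submodClosed H,
           maximal_interval_subspace T `[0, mu] Y1 ->
           maximal_interval_subspace T `[0, mu] Y2 ->
           isomorphic (subsp Y1) (subsp Y2) /\ same_hilbert_dim Y1 Y2
       & forall Y : submodClosed H,
           maximal_interval_subspace T `[0, mu] Y ->
           isomorphic (subsp Y) (subsp (lrange (E `[0, mu]%classic))) /\
           same_hilbert_dim Y (lrange (E `[0, mu]%classic))]) /\
  (forall mu mu' : R, 0 <= mu' -> mu' <= mu ->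
     forall Y Y' : submodClosed H,
       maximal_interval_subspace T `[0, mu] Y ->
       maximal_interval_subspace T `[0, mu'] Y' ->
       {subset Y' <= Y} ->
       isomorphic (quotsp (subsp_in Y Y'))
                  (subsp (lrange (E `]mu', mu]%classic)))).
Proof.
move=> _ adjT [/lbounded_nearP bA pA AA] EA.
have sA := positive_symmetric pA.
have Amax mu Y : 0 <= mu -> maximal_interval_subspace A `[0, mu] Y <->
    maxnonpos (shift_op (A \o A) (mu ^+ 2)) Y.
  by apply: maximal_interval_subspaceP => x; rewrite /= -sA.
have Tmax mu Y : 0 <= mu -> maximal_interval_subspace T `[0, mu] Y <->
    maxnonpos (shift_op (A \o A) (mu ^+ 2)) Y.
  apply: maximal_interval_subspaceP => x; rewrite /= AA ripC.
  by rewrite /rip adjT inner_conj.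
split=> [mu mu0|mu mu' mu'0 mu'mu Y Y'].
  split=> [Y|Y1 Y2|Y]; first by rewrite Tmax// Amax.
  - move=> /Tmax m1 /Tmax m2.
    by apply: (maxnonpos_isomorphic2 bA pA EA mu0); [exact: m1|exact: m2].
  - by move=> /Tmax mY; apply: (maxnonpos_isomorphic bA pA EA mu0); exact: mY.
have mu0 := le_trans mu'0 mu'mu.
move=> /(Tmax _ _ mu0) mY /(Tmax _ _ mu'0) mY'.
by move=> Y'Y; apply: (maxnonpos_quotient bA pA EA mu'0 mu'mu mY mY').
Qed.
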